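(* Let $n\ge 2$ be an integer. Then $\Gamma_0(2^n)$ has a Farey sequence $\{e_i\}$ (in the sense defined in the context) such that $e_i\le 2^{n-1}$ for all $i$, and there is a unique index $j$ with $e_j=2^{n-1}$.
   Context: $\Gamma_0(N)$ is the subgroup of $PSL(2,\mathbb Z)$ of matrices whose $(2,1)$-entry is divisible by $N$. A (finite) Farey sequence is a sequence of positive integers obtained from the sequence $(1,1)$ by repeatedly choosing two adjacent terms $a,b$ and inserting $a+b$ between them; equivalently, it is the sequence of denominators $e_1,\dots,e_m$ of reduced fractions $0/1=a_1/e_1<a_2/e_2<\dots<a_m/e_m=1/1$ with $a_{i+1}e_i-a_ie_{i+1}=1$ for all $i$ (the numerators are determined by the denominators). A side of a Farey sequence is an ordered pair $(e_i,e_{i+1})$ of consecutive terms. For a fixed $N$, a side $(a,b)$ is even if $N\mid a^2+b^2$, odd if $N\mid a^2+ab+b^2$, and elliptic if it is even or odd; two distinct sides $(a,b)$ and $(x,y)$ are paired if $N\mid ax+by$. For $r=\lfloor\sqrt N\rfloor$, $F_r$ denotes the ordered sequence of denominators of the Farey fractions in $[0,1]$ of order $r$ (all reduced fractions in $[0,1]$ with denominator $\le r$, in increasing order). A Farey sequence $F$ is a Farey sequence of $\Gamma_0(N)$ if it is obtained from $F_r$ by the insertion process, has $1+\lfloor [PSL(2,\mathbb Z):\Gamma_0(N)]/3\rfloor$ terms, and every non-elliptic side of $F$ is paired with exactly one other side of $F$. Such a sequence, together with $\infty$, gives the cusps of a special polygon (fundamental domain) of $\Gamma_0(N)$ whose side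 pairings form an independent generating set of $\Gamma_0(N)$. *)

(* Defs.v *)
From HB Require Import structures.
From mathcomp Require Import all_boot all_order all_algebra.
From mathcomp Require Import generic_quotient.

Set Implicit Arguments.
Unset Strict Implicit.
Unset Printing Implicit Defensive.

Import Order.TTheory GRing.Theory Num.Theory.

Local Open Scope ring_scope.
Local Open Scope quotient_scope.

Record SL2Z := SL2Z_of { SL2Z_mx :> 'M[int]_2; SL2Z_det : \det SL2Z_mx == 1 }.

HB.instance Definition _ := [isSub for SL2Z_mx].
HB.instance Definition _ := [Choice of SL2Z by <:].

Lemma SL2Z_one_subproof : \det (1%:M : 'M[int]_2) == 1.
Proof. by rewrite det1. Qed.

Lemma SL2Z_mul_subproof (A B : SL2Z) : \det (A *m B) == 1.
Proof. by rewrite det_mulmx (eqP (SL2Z_det A)) (eqP (SL2Z_det B)) mulr1. Qed.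

Lemma SL2Z_inv_subproof (A : SL2Z) : \det (\adj A) == 1.
Proof.
have := congr1 determinant (mul_mx_adj A).
by rewrite det_mulmx (eqP (SL2Z_det A)) mul1r det1 => ->.
Qed.

Lemma SL2Z_opp_subproof (A : SL2Z) : \det (- SL2Z_mx A) == 1.
Proof. by rewrite -scaleN1r detZ sqrrN expr1n mul1r SL2Z_det. Qed.

Definition SL2Z_one : SL2Z := SL2Z_of SL2Z_one_subproof.
Definition SL2Z_mul (A B : SL2Z) : SL2Z := SL2Z_of (SL2Z_mul_subproof A B).
Definition SL2Z_inv (A : SL2Z) : SL2Z := SL2Z_of (SL2Z_inv_subproof A).
Definition SL2Z_opp (A : SL2Z) : SL2Z := SL2Z_of (SL2Z_opp_subproof A).

Lemma SL2Z_mulA : associative SL2Z_mul.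
Proof. by move=> A B C; apply/val_inj/mulmxA. Qed.

Lemma SL2Z_mul1 : left_id SL2Z_one SL2Z_mul.
Proof. by move=> A; apply/val_inj/mul1mx. Qed.

Lemma SL2Z_mulr1 : right_id SL2Z_one SL2Z_mul.
Proof. by move=> A; apply/val_inj/mulmx1. Qed.

Lemma SL2Z_mulV : left_inverse SL2Z_one SL2Z_inv SL2Z_mul.
Proof.
by move=> A; apply: val_inj; rewrite /= mul_adj_mx (eqP (SL2Z_det A)).
Qed.

Lemma SL2Z_mulrV : right_inverse SL2Z_one SL2Z_inv SL2Z_mul.
Proof.
by move=> A; apply: val_inj; rewrite /= mul_mx_adj (eqP (SL2Z_det A)).
Qed.

HB.instance Definition _ := isGroup.Build SL2Z
  SL2Z_mulA SL2Z_mul1 SL2Z_mulr1 SL2Z_mulV SL2Z_mulrV.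

Definition eq_up_to_sign (A B : SL2Z) : bool := (A == B) || (A == SL2Z_opp B).

Lemma SL2Z_oppK : involutive SL2Z_opp.
Proof. by move=> A; apply: val_inj; rewrite /= opprK. Qed.

Lemma eq_up_to_sign_refl : reflexive eq_up_to_sign.
Proof. by move=> A; rewrite /eq_up_to_sign eqxx. Qed.

Lemma eq_up_to_sign_sym : symmetric eq_up_to_sign.
Proof.
move=> A B; rewrite /eq_up_to_sign [B == A]eq_sym; congr (_ || _).
by apply/eqP/eqP => ->; rewrite SL2Z_oppK.
Qed.

Lemma eq_up_to_sign_trans : transitive eq_up_to_sign.
Proof.
move=> B A C /orP[/eqP-> //|/eqP->] /orP[]/eqP->;
  by rewrite /eq_up_to_sign ?SL2Z_oppK eqxx ?orbT.
Qed.

Canonical eq_up_to_sign_equiv :=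
  EquivRel eq_up_to_sign eq_up_to_sign_refl eq_up_to_sign_sym
    eq_up_to_sign_trans.

Definition PSL2Z := {eq_quot eq_up_to_sign}.

HB.instance Definition _ := Choice.on PSL2Z.
HB.instance Definition _ : EqQuotient _ eq_up_to_sign PSL2Z :=
  EqQuotient.on PSL2Z.

Definition PSL2Z_one : PSL2Z := \pi_PSL2Z SL2Z_one.
Definition PSL2Z_mul : PSL2Z -> PSL2Z -> PSL2Z := lift_op2 PSL2Z SL2Z_mul.
Definition PSL2Z_inv : PSL2Z -> PSL2Z := lift_op1 PSL2Z SL2Z_inv.

Lemma SL2Z_mul_oppl (A B : SL2Z) :
  SL2Z_mul (SL2Z_opp A) B = SL2Z_opp (SL2Z_mul A B).
Proof. by apply: val_inj; rewrite /= mulNmx. Qed.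

Lemma SL2Z_mul_oppr (A B : SL2Z) :
  SL2Z_mul A (SL2Z_opp B) = SL2Z_opp (SL2Z_mul A B).
Proof. by apply: val_inj; rewrite /= mulmxN. Qed.

Lemma SL2Z_inv_opp (A : SL2Z) : SL2Z_inv (SL2Z_opp A) = SL2Z_opp (SL2Z_inv A).
Proof.
rewrite -[LHS]SL2Z_mulr1 -(SL2Z_mulrV A).
rewrite -[X in SL2Z_mul _ X]SL2Z_oppK -SL2Z_mul_oppl SL2Z_mul_oppr.
by rewrite SL2Z_mulA SL2Z_mulV SL2Z_mul1.
Qed.

Lemma pi_SL2Z_oppE (A : SL2Z) : \pi_PSL2Z (SL2Z_opp A) = \pi_PSL2Z A.
Proof. by apply/eqmodP; rewrite /= /eq_up_to_sign eqxx orbT. Qed.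

Lemma repr_PSL2Z (A : SL2Z) :
  repr (\pi_PSL2Z A) = A \/ repr (\pi_PSL2Z A) = SL2Z_opp A.
Proof.
by have /eqmodP /orP[/eqP|/eqP] := reprK (\pi_PSL2Z A); [left|right].
Qed.

Lemma pi_PSL2Z_mul : {morph \pi_PSL2Z : A B / SL2Z_mul A B >-> PSL2Z_mul A B}.
Proof.
move=> A B; unlock PSL2Z_mul.
by case: (repr_PSL2Z A) => ->; case: (repr_PSL2Z B) => ->;
  rewrite ?SL2Z_mul_oppl ?SL2Z_mul_oppr ?pi_SL2Z_oppE.
Qed.

Lemma pi_PSL2Z_inv : {morph \pi_PSL2Z : A / SL2Z_inv A >-> PSL2Z_inv A}.
Proof.
move=> A; unlock PSL2Z_inv.
by case: (repr_PSL2Z A) => ->; rewrite ?SL2Z_inv_opp ?pi_SL2Z_oppE.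
Qed.

Canonical PSL2Z_mul_morph := PiMorph2 pi_PSL2Z_mul.
Canonical PSL2Z_inv_morph := PiMorph1 pi_PSL2Z_inv.

Lemma PSL2Z_mulA : associative PSL2Z_mul.
Proof.
elim/quotW=> A; elim/quotW=> B; elim/quotW=> C.
by rewrite -!pi_PSL2Z_mul SL2Z_mulA.
Qed.

Lemma PSL2Z_mul1 : left_id PSL2Z_one PSL2Z_mul.
Proof. by elim/quotW=> A; rewrite -pi_PSL2Z_mul SL2Z_mul1. Qed.

Lemma PSL2Z_mulr1 : right_id PSL2Z_one PSL2Z_mul.
Proof. by elim/quotW=> A; rewrite -pi_PSL2Z_mul SL2Z_mulr1. Qed.

Lemma PSL2Z_mulV : left_inverse PSL2Z_one PSL2Z_inv PSL2Z_mul.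
Proof.
by elim/quotW=> A; rewrite -pi_PSL2Z_inv -pi_PSL2Z_mul SL2Z_mulV.
Qed.

Lemma PSL2Z_mulrV : right_inverse PSL2Z_one PSL2Z_inv PSL2Z_mul.
Proof.
by elim/quotW=> A; rewrite -pi_PSL2Z_inv -pi_PSL2Z_mul SL2Z_mulrV.
Qed.

HB.instance Definition _ := isGroup.Build PSL2Z
  PSL2Z_mulA PSL2Z_mul1 PSL2Z_mulr1 PSL2Z_mulV PSL2Z_mulrV.

(* The rows and columns of a matrix are numbered from 0, so the (2,1)-entry
   of A is A 1 0; whether N divides it does not depend on the sign of A. *)
Definition Gamma0 (N : nat) : {pred PSL2Z} :=
  fun g => (N%:Z %| (SL2Z_mx (repr g) 1 0)%R)%Z.

Lemma Gamma0_pi (N : nat) (A : SL2Z) :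
  (\pi_PSL2Z A \in Gamma0 N) = (N%:Z %| (SL2Z_mx A 1 0)%R)%Z.
Proof.
rewrite unfold_in /Gamma0; case: (repr_PSL2Z A) => -> //=.
by rewrite mxE dvdzE abszN -dvdzE.
Qed.

Lemma Gamma0_mul_closed (N : nat) : mulg_closed (Gamma0 N).
Proof.
elim/quotW=> A; elim/quotW=> B; rewrite -[(_ * _)%g]pi_PSL2Z_mul !Gamma0_pi.
move=> NA NB; rewrite mxE !big_ord_recl big_ord0 /= addr0 rpredD //.
  exact: dvdz_mulr.
by rewrite (_ : lift _ _ = 1); [exact: dvdz_mull|exact: val_inj].
Qed.

Lemma PSL2Z_oneE : (1%g : PSL2Z) = \pi_PSL2Z SL2Z_one.
Proof. by []. Qed.

Lemma Gamma0_one_closed (N : nat) : (1%g : PSL2Z) \in Gamma0 N.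
Proof. by rewrite PSL2Z_oneE Gamma0_pi mxE dvdz0. Qed.

Lemma Gamma0_inv_closed (N : nat) : invg_closed (Gamma0 N).
Proof.
elim/quotW=> A; rewrite -[(_^-1)%g]pi_PSL2Z_inv !Gamma0_pi => NA.
rewrite /= mxE /cofactor det_mx11 !mxE dvdz_mull //.
rewrite (_ : lift 0 0 = 1); last exact: val_inj.
by rewrite (_ : lift 1 0 = 0); last exact: val_inj.
Qed.

HB.instance Definition _ N :=
  isMulClosed.Build PSL2Z (Gamma0 N) (@Gamma0_mul_closed N).
HB.instance Definition _ N :=
  isMul1Closed.Build PSL2Z (Gamma0 N) (@Gamma0_one_closed N).
HB.instance Definition _ N :=
  isInvClosed.Build PSL2Z (Gamma0 N) (@Gamma0_inv_closed N).

(* The index of a subgroup of a possibly infinite group, as a relation: r lists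
   one representative of each right coset H * g. *)
Definition has_index (G : groupType) (H : groupClosed G) (k : nat) : Prop :=
  exists r : 'I_k -> G, forall g : G, exists! i : 'I_k, (g / r i)%g \in H.

Local Open Scope nat_scope.

Inductive obtained_from (s : seq nat) : seq nat -> Prop :=
| Obtained_refl : obtained_from s s
| Obtained_insert (u v : seq nat) (a b : nat) :
    obtained_from s (u ++ a :: b :: v) ->
    obtained_from s (u ++ a :: a + b :: b :: v).

Definition farey_sequence (e : seq nat) : Prop := obtained_from [:: 1; 1] e.

Definition farey_fractions (r : nat) : seq rat :=
  sort <=%O (undup [seq (a%:R / b%:R)%R | b <- iota 1 r, a <- iota 0 b.+1]).

Definition farey_denominators (r : nat) : seq nat :=
  [seq `|denq x| | x <- farey_fractions r].

Definition sides (e : seq nat) : seq (nat * nat) := zip e (behead e).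

Definition even_side (N : nat) (s : nat * nat) : bool :=
  N %| s.1 ^ 2 + s.2 ^ 2.

Definition odd_side (N : nat) (s : nat * nat) : bool :=
  N %| s.1 ^ 2 + s.1 * s.2 + s.2 ^ 2.

Definition elliptic_side (N : nat) (s : nat * nat) : bool :=
  even_side N s || odd_side N s.

Definition paired (N : nat) (s t : nat * nat) : bool :=
  (s != t) && (N %| s.1 * t.1 + s.2 * t.2).

Definition farey_sequence_of_Gamma0 (N : nat) (e : seq nat) : Prop :=
  [/\ farey_sequence e,
      obtained_from (farey_denominators (Nat.sqrt N)) e,
      exists2 k : nat, @has_index PSL2Z (Gamma0 N) k & size e = 1 + k %/ 3
    & forall s, s \in sides e -> ~~ elliptic_side N s ->
        exists! t, t \in sides e /\ paired N s t].

(* Main.v *)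
(* Put N = 2^n, M = 2^(n-1) and r = floor (sqrt N).  A Farey sequence describes
   a polygon in the Farey tessellation, made of one triangle with vertices
   a, a + b, b for each inserted term a + b, together with the triangle with
   vertices infinity, 0, 1.  There are M classes of Farey triangles modulo
   Gamma_0(N).  If one only ever inserts a + b at a side (a, b) whose outer
   triangle is not equivalent to one already present, then the polygon never
   contains two equivalent triangles, and once no such side is left it contains
   every class once and its sides are paired.

   All insertions leading to F_r are of this kind.  To keep the terms at most M
   afterwards, insert only at sides (a, b) for which a p + b q = M for some
   integers p, q >= 1 (called a label below), so that a + b <= M.  Labels are
   confined to a bounded region, where they behave like the Euclidean
   algorithm: when a + b is inserted, the labels (p, q) with p > q and p < q
   turn into the labels (p - q, q) of (a, a + b) and (p, q - p) of (a + b, b).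
   A lattice point argument shows that an uncovered side of F_r has a label, and
   that a label too large to be continued to a neighbouring triangle sits next
   to a triangle of F_r.  Hence, as long as some class is missing, replacing
   a label by (p + q, q) across its edge, again and again, leads to a labelled
   side at which one can insert. *)

Require Import Defs.
From mathcomp Require Import all_boot.
From mathcomp Require Import all_order all_algebra generic_quotient.
From mathcomp Require Import zify ring.
From Stdlib Require PeanoNat.

Set Implicit Arguments.
Unset Strict Implicit.
Unset Printing Implicit Defensive.

Import Order.TTheory GRing.Theory Num.Theory.

Lemma dvdz_opp (d x : int) : (d %| (- x)%R)%Z = (d %| x)%Z.
Proof. by rewrite !dvdzE abszN. Qed.

(** * Farey fractions *)

Section FareyDenominators.

Local Open Scope ring_scope.

Definition frac (x : nat * nat) : rat := x.1%:R / x.2%:R.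

Definition adjacent (x y : nat * nat) : bool := (y.1 * x.2 == x.1 * y.2 + 1)%N.

Lemma obtained_from_head (s e : seq nat) :
  obtained_from s e -> head 0%N e = head 0%N s.
Proof. by elim=> [//|[|x u] v a b _]. Qed.

Lemma obtained_from_gt0 (s e : seq nat) : obtained_from s e ->
  {in s, forall a, (0 < a)%N} -> {in e, forall a, (0 < a)%N}.
Proof.
elim=> // u v a b _ IH /IH pos c; rewrite mem_cat !inE => c_in.
have [->|ne] := eqVneq c (a + b)%N.
  by rewrite addn_gt0 pos // mem_cat mem_head orbT.
by apply: pos; rewrite mem_cat !inE; move: c_in; rewrite (negPf ne).
Qed.

Lemma farey_numerators (e : seq nat) : farey_sequence e -> exists g,
  [/\ map snd g = e, sorted adjacent g, head (0, 0)%N g = (0, 1)%N,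
      last (0, 0)%N g = (1, 1)%N
    & all (fun x => coprime x.1 x.2 && (x.1 <= x.2)%N) g].
Proof.
elim=> [|u v a b _ [g [eq_g g_sorted g_head g_last g_red]]].
  by exists [:: (0, 1); (1, 1)]%N.
have eq_u : map snd (take (size u) g) = u by rewrite map_take eq_g take_size_cat.
have := congr1 (drop (size u)) eq_g; rewrite -map_drop drop_size_cat //.
rewrite -(cat_take_drop (size u) g) in g_sorted g_head g_last g_red.
case: (drop (size u) g) g_sorted g_head g_last g_red => [//|[x a'] [//|[y b'] gv]].
move: (take (size u) g) eq_u => gu <- g_sorted g_head g_last g_red [ea eb <-].
rewrite {}ea {}eb in g_sorted g_head g_last g_red.
exists (gu ++ (x, a) :: (x + y, a + b)%N :: (y, b) :: gv); split.
- by rewrite map_cat.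
- move: g_sorted; rewrite !sorted_cat_cons => /andP[-> /= /andP[adj ->]].
  move: adj; rewrite /adjacent /= andbT => /eqP adj.
  by apply/andP; split; apply/eqP; lia.
- by case: gu g_head {g_sorted g_last g_red}.
- by move: g_last; rewrite !last_cat.
move: g_red; rewrite !all_cat /= => /and4P[-> /andP[-> le1] /andP[-> le2] ->].
rewrite le1 le2 leq_add // !andbT.
move: g_sorted; rewrite sorted_cat_cons => /andP[_ /= /andP[/eqP /= adj _]].
(* The mediant is reduced because (x + y) a - x (a + b) = y a - x b = 1. *)
rewrite /coprime -dvdn1 -(@dvdn_addr (x * (a + b))) ?dvdn_mull ?dvdn_gcdr //.
by rewrite (_ : _ + 1 = (x + y) * a)%N ?dvdn_mulr ?dvdn_gcdl //; lia.
Qed.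

Lemma adjacent_frac (x y : nat * nat) :
  (0 < x.2)%N -> (0 < y.2)%N -> adjacent x y -> frac x < frac y.
Proof.
move=> x_gt0 y_gt0 /eqP adj; rewrite /frac ltr_pdivrMr ?ltr0n // mulrAC.
by rewrite ltr_pdivlMr ?ltr0n // -!natrM ltr_nat adj addn1.
Qed.

(* If p/q lies strictly between adjacent a/b and c/d, then
   q = b (c q - p d) + d (p b - a q) >= b + d. *)
Lemma farey_complete (r p q : nat) (x : nat * nat) (g : seq (nat * nat)) :
    path (fun x y => adjacent x y && (r < x.2 + y.2)%N) x g -> (q <= r)%N ->
    (x.1 * q <= p * x.2)%N -> (p * (last x g).2 <= (last x g).1 * q)%N ->
  exists2 y, y \in x :: g & (p * y.2 = y.1 * q)%N.
Proof.
elim: g x => [|y g IHg] x /=.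
  move=> _ _ le1 le2; exists x; first exact: mem_head.
  by apply/eqP; rewrite eqn_leq le1 le2.
case/andP=> /andP[/eqP adj big] g_path q_le le_x le_last.
have [le_y|lt_y] := leqP (y.1 * q) (p * y.2).
  have [z z_in eq_z] := IHg y g_path q_le le_y le_last.
  by exists z; rewrite // inE z_in orbT.
exists x; first exact: mem_head.
apply/eqP; rewrite eqn_leq le_x andbT leqNgt; apply/negP => lt_x.
have eq_q : (q * (y.1 * x.2) = q * (x.1 * y.2) + q)%N by rewrite adj mulnDr muln1.
have h1 : (x.2 * (p * y.2).+1 <= x.2 * (y.1 * q))%N by rewrite leq_mul.
have h2 : (y.2 * (x.1 * q).+1 <= y.2 * (p * x.2))%N by rewrite leq_mul.
nia.
Qed.

Lemma path_adjacent (r : nat) (x : nat * nat) (g : seq (nat * nat)) :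
    {in sides (map snd (x :: g)), forall s : nat * nat, (r < s.1 + s.2)%N} ->
    path adjacent x g ->
  path (fun x y => adjacent x y && (r < x.2 + y.2)%N) x g.
Proof.
elim: g x => //= y g IHg x big /andP[-> g_path].
rewrite (big (x.2, y.2)) ?mem_head // IHg // => s s_in.
by apply: big; rewrite inE s_in orbT.
Qed.

(** Adjacency makes the fractions increase, and [farey_complete] shows that none of denominator at
    most [r] is missing. Two sorted lists with the same elements are equal. *)
Lemma farey_denominatorsE (r : nat) (e : seq nat) :
    farey_sequence e -> {in e, forall a, (a <= r)%N} ->
    {in sides e, forall s : nat * nat, (r < s.1 + s.2)%N} ->
  farey_denominators r = e.
Proof.
move=> far le big.
have [g [eq_g g_sorted g_head g_last g_red]] := farey_numerators far.
have pos : {in e, forall a, (0 < a)%N}.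
  by apply: (obtained_from_gt0 far) => a; rewrite !inE orbb => /eqP->.
have g_pos x : x \in g -> (0 < x.2)%N by move=> x_in; rewrite pos // -eq_g map_f.
have g_le x : x \in g -> (x.2 <= r)%N by move=> x_in; rewrite le // -eq_g map_f.
have frac_sorted : sorted <%R (map frac g).
  rewrite sorted_map; apply: (sub_in_sorted (P := mem g)) g_sorted.
    by move=> x y /g_pos x_gt0 /g_pos y_gt0; exact: adjacent_frac.
  exact/allP.
have frac_eq (x : nat * nat) (p q : nat) : (0 < x.2)%N -> (0 < q)%N ->
    (p * x.2 = x.1 * q)%N -> p%:R / q%:R = frac x.
  move=> x_gt0 q_gt0 eq_pq; apply/eqP.
  by rewrite eqr_div ?pnatr_eq0 ?lt0n_neq0 // -!natrM eq_pq.
rewrite /farey_denominators; have -> : farey_fractions r = map frac g.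
  apply: le_sorted_eq; first exact/sort_sorted/le_total.
    by move: frac_sorted; rewrite lt_sorted_uniq_le => /andP[].
  rewrite perm_sort; apply: uniq_perm; rewrite ?undup_uniq //.
    exact: lt_sorted_uniq frac_sorted.
  move=> z; rewrite mem_undup.
  apply/allpairsPdep/mapP => [[q [p [q_in p_in ->]]]|[x x_in ->]].
    rewrite !mem_iota in q_in p_in.
    case: g g_head g_last g_sorted g_pos eq_g {g_le g_red frac_sorted} => //= x g.
    move=> -> g_last g_path g_pos eq_g.
    have big' : {in sides (map snd ((0, 1)%N :: g)),
        forall s : nat * nat, (r < s.1 + s.2)%N}.
      by rewrite /= eq_g.
    have [|||y y_in eq_y] :=
      farey_complete (p := p) (q := q) (path_adjacent big' g_path).
    - by lia.
    - by [].
    - by rewrite g_last /=; lia.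
    by exists y => //; apply: frac_eq; rewrite ?g_pos //; lia.
  have /andP[_ x_le] := allP g_red _ x_in.
  have x_gt0 := g_pos _ x_in; have x_ler := g_le _ x_in.
  by exists x.2, x.1; rewrite !mem_iota; split=> //; lia.
rewrite -eq_g -map_comp; apply/eq_in_map => x x_in /=.
have /andP[co _] := allP g_red _ x_in; have := @coprimeq_den x.1 x.2 co.
have x_gt0 := g_pos _ x_in.
by rewrite eqz_nat gtn_eqF // => den_x; rewrite /frac [denq _]den_x.
Qed.

End FareyDenominators.

(** * The index of Gamma_0(2^n) *)

Section Index.

Local Open Scope ring_scope.
Local Open Scope quotient_scope.

Definition mx22 (a b c d : int) : 'M[int]_2 :=
  \matrix_(i, j) if i == 0 then (if j == 0 then a else b)
                 else (if j == 0 then c else d).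

Lemma det_mx22 (A : 'M[int]_2) : \det A = A 0 0 * A 1 1 - A 0 1 * A 1 0.
Proof.
rewrite (expand_det_row _ 0) !big_ord_recl big_ord0 addr0 /cofactor !det_mx11 !mxE.
have l01 : lift 0 0 = 1 :> 'I_2 by apply: val_inj.
have l10 : lift 1 0 = 0 :> 'I_2 by apply: val_inj.
by rewrite /= l01 l10 /= expr0 expr1 mul1r mulN1r mulrN.
Qed.

Definition SL2Z_bottom (a b c d : int) (e : a * d - b * c = 1) : SL2Z.
Proof. by exists (mx22 a b c d); rewrite det_mx22 !mxE e. Defined.

Lemma SL2Z_div_bottom (A B : SL2Z) :
  SL2Z_mx (SL2Z_mul A (SL2Z_inv B)) 1 0
  = SL2Z_mx A 1 0 * SL2Z_mx B 1 1 - SL2Z_mx A 1 1 * SL2Z_mx B 1 0.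
Proof.
rewrite /= !mxE !big_ord_recl big_ord0 addr0 !mxE /cofactor !det_mx11 !mxE.
have l01 : lift 0 0 = 1 :> 'I_2 by apply: val_inj.
have l10 : lift 1 0 = 0 :> 'I_2 by apply: val_inj.
by rewrite /= !l01 !l10 /= expr0 expr1 mul1r mulN1r mulrN.
Qed.

Lemma Gamma0_div (N : nat) (A B : SL2Z) :
  ((\pi_PSL2Z A / \pi_PSL2Z B)%g \in Gamma0 N)
  = (SL2Z_mx A 1 0 * SL2Z_mx B 1 1 - SL2Z_mx A 1 1 * SL2Z_mx B 1 0 \in dvdz N).
Proof.
rewrite -SL2Z_div_bottom -[RHS](Gamma0_pi N (SL2Z_mul A (SL2Z_inv B))).
by rewrite pi_PSL2Z_mul pi_PSL2Z_inv.
Qed.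

Lemma congruence_solution (k : nat) (c d : int) : (0 < k)%N -> coprimez c k ->
  exists2 i : 'I_k, (k%:Z %| c * i%:Z - d)%Z &
    forall j : 'I_k, (k%:Z %| c * j%:Z - d)%Z -> j = i.
Proof.
move=> k_gt0 co; have /coprimezP[[u v] /= eq_uv] := co.
have k0 : k%:Z != 0 by rewrite eqz_nat -lt0n.
have ge0 := modz_ge0 (u * d) k0.
have lt_k : modz (u * d) k < k%:Z by have := ltz_mod (u * d) k0; lia.
have eq_i : Posz (absz (modz (u * d) k)) = modz (u * d) k by lia.
have i_lt : (absz (modz (u * d) k) < k)%N by rewrite -ltz_nat eq_i.
have d_i : (k%:Z %| c * (Ordinal i_lt)%:Z - d)%Z.
  rewrite /= eq_i; apply/dvdzP; exists (- v * d - c * divz (u * d) k).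
  have := divz_eq (u * d) k; move: (modz _ _) (divz _ _) => x y exy.
  have -> : x = u * d - y * k%:Z by rewrite exy; ring.
  transitivity (d * (u * c) - d - c * y * k%:Z); first by ring.
  by rewrite (canRL (addrK _) eq_uv); ring.
exists (Ordinal i_lt) => // j d_j; apply/val_inj.
have : (k%:Z %| j%:Z - (Ordinal i_lt)%:Z)%Z.
  rewrite -(@Gauss_dvdzr _ c) 1?coprimez_sym //.
  have -> : c * (j%:Z - (Ordinal i_lt)%:Z) =
    (c * j%:Z - d) - (c * (Ordinal i_lt)%:Z - d) by ring.
  by apply: rpredB.
case: j (Ordinal i_lt) {d_j d_i} => j j_lt [i i_lt'] /=.
rewrite dvdzE /= => dvd_k; have [//|ne] := eqVneq j i.
have := dvdn_leq _ dvd_k; lia.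
Qed.

(** A coset is determined by its bottom row (c : d), a point of the projective line over Z/N. The
    points are (1 : i) with i < N for odd c, and (2 j : 1) with j < M for even c. *)
Lemma Gamma0_index (n : nat) : (0 < n)%N ->
  @has_index PSL2Z (Gamma0 (2 ^ n)) (2 ^ n + 2 ^ n.-1).
Proof.
move=> n_gt0; set N := (2 ^ n)%N; set M := (2 ^ n.-1)%N.
have N_M : N = (2 * M)%N by rewrite /N /M -expnS prednK.
have M_gt0 : (0 < M)%N by rewrite expn_gt0.
have co_pow2 (c : int) k : ~~ (2 %| c)%Z -> coprimez c (2 ^ k)%N.
  move=> odd_c; rewrite coprimezE /= coprimeXr // coprime_sym coprime2n.
  by move: odd_c; clear; lia.
have odd_rep (i : nat) : 0 * i%:Z - (-1) * 1 = 1 :> int by ring.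
have even_rep (j : nat) : 1 * 1 - 0 * (2 * j%:Z) = 1 :> int by ring.
exists (fun i => match split i with
  | inl i => \pi_PSL2Z (SL2Z_bottom (odd_rep i))
  | inr j => \pi_PSL2Z (SL2Z_bottom (even_rep j)) end).
elim/quotW=> A; set c := SL2Z_mx A 1 0; set d := SL2Z_mx A 1 1.
have testl (i : 'I_N) : ((\pi_PSL2Z A / \pi_PSL2Z (SL2Z_bottom (odd_rep i)))%g
    \in Gamma0 N) = (N%:Z %| c * i%:Z - d)%Z.
  by rewrite Gamma0_div /= !mxE /= mulr1.
have testr (j : 'I_M) : ((\pi_PSL2Z A / \pi_PSL2Z (SL2Z_bottom (even_rep j)))%g
    \in Gamma0 N) = (N%:Z %| c - d * (2 * j%:Z))%Z.
  by rewrite Gamma0_div /= !mxE /= mulr1.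
have odd_cd : ~~ ((2 %| c)%Z && (2 %| d)%Z).
  apply/negP => /andP[/dvdzP[c' ec] /dvdzP[d' ed]].
  have := eqP (SL2Z_det A); rewrite det_mx22 -/c -/d ec ed; clear; lia.
have dvd2N x : (N%:Z %| x)%Z -> (2 %| x)%Z.
  by apply: dvdz_trans; rewrite N_M dvdzE /= dvdn_mulr.
have [even_c|odd_c] := boolP ((2 %| c)%Z).
  have odd_d : ~~ (2 %| d)%Z by move: odd_cd; rewrite even_c.
  have /dvdzP[c' ec] := even_c.
  have [j d_j uniq_j] := congruence_solution c' M_gt0 (co_pow2 d n.-1 odd_d).
  have halve (i : 'I_M) : (N%:Z %| c - d * (2 * i%:Z))%Z = (M%:Z %| d * i%:Z - c')%Z.
    have N2M : N%:Z = 2 * M%:Z by rewrite N_M PoszM.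
    rewrite -[RHS](@dvdz_mul2l 2 M) // -N2M -[LHS]dvdz_opp.
    by congr (_ %| _)%Z; rewrite ec; ring.
  exists (rshift N j); split.
    by rewrite (unsplitK (inr j)) testr halve.
  move=> i; rewrite -(splitK i); case: (split i) => i'.
    rewrite (unsplitK (inl i')) testl => /dvd2N d_i.
    by case/negP: odd_d; move: d_i; rewrite ec; clear; lia.
  by rewrite (unsplitK (inr i')) testr halve => /uniq_j->.
have N_gt0 : (0 < N)%N by rewrite expn_gt0.
have [i d_i uniq_i] := congruence_solution d N_gt0 (co_pow2 c n odd_c).
exists (lshift M i); split.
  by rewrite (unsplitK (inl i)) testl.
move=> j; rewrite -(splitK j); case: (split j) => j'.
  by rewrite (unsplitK (inl j')) testl => /uniq_i->.
rewrite (unsplitK (inr j')) testr => /dvd2N d_j.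
by case/negP: odd_c; move: d_j; clear; lia.
Qed.

End Index.

(** * Polygons modulo Gamma_0(2^n) *)

Section Triangles.

Local Open Scope ring_scope.

Variables n N M : nat.
Hypotheses (n_ge2 : (2 <= n)%N) (N_def : N = (2 ^ n)%N) (M_def : M = (2 ^ n.-1)%N).
Local Notation R := 'Z_N.

Let N_M : N = (2 * M)%N.
Proof. by rewrite N_def M_def -expnS prednK // (leq_trans _ n_ge2). Qed.

Let M_even : exists2 h, M = (2 * h)%N & (0 < h)%N.
Proof.
exists (2 ^ n.-2)%N; last by rewrite expn_gt0.
by rewrite M_def -expnS; case: n n_ge2 => [|[|k]].
Qed.

Let N_gt1 : (1 < N)%N.
Proof. by have [h] := M_even; lia. Qed.

Let dvd2N (x : int) : (N %| x)%Z -> (2 %| x)%Z.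
Proof. by apply: dvdz_trans; rewrite N_M dvdzE /= dvdn_mulr. Qed.

Lemma intr_Zp_eq0 (x : int) : (x%:~R == 0 :> R) = (N %| x)%Z.
Proof.
have natE (k : nat) : (k%:R == 0 :> R) = (N %| k)%N.
  by rewrite -val_eqE /= val_Zp_nat.
by case: x => k; rewrite ?NegzE ?rmorphN ?oppr_eq0 dvdzE; apply: natE.
Qed.

Lemma odd_unit (x : int) : ~~ (2 %| x)%Z -> (x%:~R : R) \is a GRing.unit.
Proof.
have natE (k : nat) : odd k -> (k%:R : R) \is a GRing.unit.
  by move=> ok; rewrite unitZpE // N_def coprimeXl // coprime2n.
by case: x => k o; rewrite ?NegzE ?rmorphN ?unitrN; apply: natE; lia.
Qed.

Lemma odd_gauss (k x : int) : ~~ (2 %| k)%Z -> (N %| k * x)%Z = (N %| x)%Z.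
Proof.
move=> ok; rewrite -!intr_Zp_eq0 rmorphM /=.
apply/eqP/eqP => [e|->]; last by rewrite mulr0.
by apply: (mulrI (odd_unit ok)); rewrite mulr0.
Qed.

(* The side (x, y) is identified with the point (x : y) of the projective line
   over Z/N, for which x and y must not both be even. *)
Definition odd_pair (x y : int) : bool := ~~ ((2 %| x)%Z && (2 %| y)%Z).

Definition same_edge (x y x' y' : int) : bool := (N %| x * y' - y * x')%Z.

Definition slope (x y : int) : R := x%:~R / y%:~R.

Lemma slope_eq (x y x' y' : int) : ~~ (2 %| y)%Z -> ~~ (2 %| y')%Z ->
  (slope x y == slope x' y') = same_edge x y x' y'.
Proof.
move=> /odd_unit uy /odd_unit uy'; rewrite /same_edge -intr_Zp_eq0 rmorphB /=.
rewrite subr_eq0 !rmorphM /= /slope.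
move: (x%:~R : R) (y%:~R : R) (x'%:~R : R) (y'%:~R : R) uy uy'.
move=> u v u' v' uv uv'; apply/eqP/eqP => [e|e].
  by rewrite -(divrK uv u) e mulrAC mulrC divrK // mulrC.
by apply: (mulIr uv); apply: (mulIr uv'); rewrite divrK // e mulrAC divrK // mulrC.
Qed.

(* The ideal triangle on the far side of (x, y) has the three oriented edges
   (x, y), (y, z) and (z, x), where x + y + z = 0.  Exactly one of x, y, z is
   even, and its quotient by the next entry determines the triangle modulo
   Gamma_0(N). *)
Definition tri (x y : int) : R :=
  if (2 %| x)%Z then slope x y
  else if (2 %| y)%Z then slope y (- x - y) else slope (- x - y) x.

Lemma tri_rot (x y : int) : odd_pair x y -> tri x y = tri y (- x - y).
Proof.
rewrite /odd_pair /tri => o.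
have -> : - y - (- x - y) = x by ring.
by do ?case: ifP => ?; first [done|exfalso; lia].
Qed.

Lemma odd_pair_rot (x y : int) : odd_pair x y -> odd_pair y (- x - y).
Proof. rewrite /odd_pair; lia. Qed.

Lemma odd_pair_rev (x y : int) : odd_pair x y -> odd_pair y (- x).
Proof. rewrite /odd_pair; lia. Qed.

Lemma same_edge_refl (x y : int) : same_edge x y x y.
Proof. by rewrite /same_edge mulrC subrr dvdz0. Qed.

Lemma same_edge_sym (x y x' y' : int) :
  same_edge x y x' y' = same_edge x' y' x y.
Proof. by rewrite /same_edge -dvdz_opp; congr (_ %| _)%Z; ring. Qed.

Lemma same_edge_trans (x y x1 y1 x2 y2 : int) : odd_pair x y ->
  same_edge x y x1 y1 -> same_edge x y x2 y2 -> same_edge x1 y1 x2 y2.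
Proof.
rewrite /odd_pair negb_and => o e1 e2; rewrite /same_edge.
case/orP: o => o; rewrite -(odd_gauss _ o).
  have -> : x * (x1 * y2 - y1 * x2) =
    x1 * (x * y2 - y * x2) - x2 * (x * y1 - y * x1) by ring.
  by rewrite rpredB // dvdz_mull.
have -> : y * (x1 * y2 - y1 * x2) =
  y1 * (x * y2 - y * x2) - y2 * (x * y1 - y * x1) by ring.
by rewrite rpredB // dvdz_mull.
Qed.

Lemma same_edge_opp (x y x' y' : int) :
  same_edge x y (- x') (- y') = same_edge x y x' y'.
Proof. by rewrite /same_edge -dvdz_opp; congr (_ %| _)%Z; ring. Qed.

(** The pair (y, - x) is the edge (x, y) with the opposite orientation, so [tri y (- x)] is the
    class of the triangle on its other side. *)
Lemma same_edge_rev (x y x' y' : int) :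
  same_edge x y x' y' -> same_edge y (- x) y' (- x').
Proof. by rewrite /same_edge; congr (_ %| _)%Z; ring. Qed.

Lemma same_edge_parity (x y x' y' : int) :
  odd_pair x y -> odd_pair x' y' -> same_edge x y x' y' ->
  ((2 %| x)%Z = (2 %| x')%Z) * ((2 %| y)%Z = (2 %| y')%Z).
Proof.
rewrite /odd_pair => o o' /dvd2N; move: o o'.
have : (2 %| x * y' - y * x')%Z ->
   ((2 %| x)%Z || (2 %| y')%Z) = ((2 %| y)%Z || (2 %| x')%Z).
  by move=> d; apply/idP/idP; nia.
by move=> h o o' /h; split; lia.
Qed.

Lemma tri_same_edge (x y x' y' : int) :
  odd_pair x y -> odd_pair x' y' -> same_edge x y x' y' -> tri x y = tri x' y'.
Proof.
move=> o o' e; have [px py] := same_edge_parity o o' e.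
rewrite /tri -px -py; move: o; rewrite /odd_pair => o.
case: ifP => ex; first by apply/eqP; rewrite slope_eq //; lia.
by case: ifP => ey; apply/eqP; rewrite slope_eq; try (by lia);
  move: e; rewrite /same_edge; congr (_ %| _)%Z; ring.
Qed.

(** Equal classes mean that the edges at the even entries agree; undoing the rotations that lead to
    these edges leaves three possible matches. *)
Lemma tri_inj (x y x' y' : int) :
  odd_pair x y -> odd_pair x' y' -> tri x y = tri x' y' ->
  [\/ same_edge x y x' y', same_edge x y y' (- x' - y')
    | same_edge x y (- x' - y') x'].
Proof.
rewrite /odd_pair /tri => o o' /eqP.
case: ifP => ex; case: ifP => ex'.
all: try case: ifP => ey; try case: ifP => ey'; rewrite slope_eq; try (by lia).
all: rewrite /same_edge => d.
all: by [constructor 1; congr (_ %| _)%Z: d; ring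
        |constructor 2; congr (_ %| _)%Z: d; ring
        |constructor 3; congr (_ %| _)%Z: d; ring].
Qed.

Definition even_residues : seq R := [seq (2 * j)%:R | j <- iota 0 M].

Lemma tri_even (x y : int) : odd_pair x y -> tri x y \in even_residues.
Proof.
have slope_even (u v : int) : (2 %| u)%Z -> slope u v \in even_residues.
  case/dvdzP => w ->; rewrite /slope rmorphM /= mulrAC.
  set z : R := w%:~R / v%:~R; apply/mapP; exists (z %% M)%N.
    by rewrite mem_iota /= ltn_mod; have [h] := M_even; lia.
  (* Since N = 2 M, the double of [z] depends only on [z] modulo [M]. *)
  rewrite -[in LHS](natr_Zp z) -[2%:~R]/(2%:R) -natrM; move: (nat_of_ord z) => k.
  by apply: val_inj; rewrite /= !val_Zp_nat // mulnC N_M -!muln_modr modn_mod.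
rewrite /odd_pair /tri => o.
by case: ifP => ex; [|case: ifP => ey]; apply: slope_even; lia.
Qed.

Lemma tri0y (y : int) : tri 0 y = 0.
Proof. by rewrite /tri dvdz0 /slope mul0r. Qed.

Lemma tri_opp (x y : int) : odd_pair x y -> tri (- x) (- y) = tri x y.
Proof.
move=> o; apply: tri_same_edge => //; first by move: o; rewrite /odd_pair; lia.
by rewrite same_edge_sym same_edge_opp same_edge_refl.
Qed.

(** This and [tri_far_r] say that the inner triangle at both sides created by an insertion at (x, y)
    is the former outer triangle of (x, y). *)
Lemma tri_far_l (x y : int) : odd_pair x y -> tri (x + y) (- x) = tri x y.
Proof.
move=> o; rewrite -tri_opp; last by move: o; rewrite /odd_pair; lia.
rewrite opprK opprD [RHS]tri_rot // [RHS]tri_rot ?odd_pair_rot //.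
by congr tri; ring.
Qed.

Lemma tri_far_r (x y : int) : odd_pair x y -> tri y (- (x + y)) = tri x y.
Proof. by move=> o; rewrite [RHS]tri_rot // opprD. Qed.

Lemma not_same_edge (x y x' y' : int) :
  ~~ (2 %| x * y' - y * x')%Z -> ~~ same_edge x y x' y'.
Proof. by apply: contra => /dvd2N. Qed.

(** Up to sign, the form is the determinant of two edges of one triangle. As it is odd, the three
    edges of a triangle are pairwise inequivalent. *)
Lemma odd_pair_form (x y : int) :
  odd_pair x y -> ~~ (2 %| x * x + x * y + y * y)%Z.
Proof.
rewrite /odd_pair => o; apply/negP => /dvdzP[q eq].
have [i [hx|hx]] : exists i, x = 2 * i \/ x = 2 * i + 1.
  by exists (x %/ 2)%Z; lia.
all: have [j [hy|hy]] : exists j, y = 2 * j \/ y = 2 * j + 1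
  by exists (y %/ 2)%Z; lia.
all: by rewrite hx hy in eq o; lia.
Qed.

(* K lists the classes of the triangles of the polygon with cusps e and
   infinity; 0 is the class of the triangle (infinity, 0, 1).  The inner edge at
   a side (a, b) is (b, - a).  By polygon_edge, an edge of a triangle in K is
   either such an inner edge or glued to another edge inside the polygon; the
   two vertical sides of the polygon, which are paired with each other, count as
   glued and account for the last disjunct. *)
Record polygon (e : seq nat) (K : seq R) : Prop := Polygon {
  polygon_uniq : uniq K;
  polygon_size : size e = (size K).+1;
  polygon_even : {subset K <= even_residues};
  polygon_root : 0 \in K;
  polygon_gt0 : {in e, forall a, (0 < a)%N};
  polygon_coprime : {in sides e, forall s : nat * nat, coprime s.1 s.2};
  polygon_distinct :
    pairwise (fun s t : nat * nat => ~~ same_edge s.1 s.2 t.1 t.2) (sides e);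
  polygon_inner : {in sides e, forall s : nat * nat, tri s.2 (- s.1%:Z) \in K};
  polygon_edge : forall x y : int, odd_pair x y -> tri x y \in K ->
    (exists2 s, s \in sides e & same_edge x y s.2 (- s.1%:Z)) \/
    [/\ tri y (- x) \in K,
        {in sides e, forall s : nat * nat, ~~ same_edge x y s.1 s.2}
      & tri y (- x) != tri x y \/ tri x y = 0]
}.

(** * Gluing a triangle to a polygon *)

Lemma sides_cat (u v : seq nat) (a b : nat) :
  sides (u ++ a :: b :: v) = sides (rcons u a) ++ (a, b) :: sides (b :: v).
Proof.
rewrite /sides; elim: u => [|x [|y u] IHu] //=.
by congr cons; apply: IHu.
Qed.

Lemma mem_sides (e : seq nat) (s : nat * nat) : s \in sides e ->
  exists u v, e = u ++ s.1 :: s.2 :: v.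
Proof.
case: e => // x e; rewrite /sides /=.
elim: e x => // y e IHe x; rewrite /= inE => /orP[/eqP->|/IHe[u [v ->]]].
  by exists [::], e.
by exists (x :: u), v.
Qed.

Lemma coprime_odd_pair (a b : nat) : coprime a b -> odd_pair a b.
Proof.
rewrite /odd_pair => co; apply/negP => /andP[da db].
by have := dvdn_gcd 2 a b; rewrite (eqP co) !dvdzE /= in da db *; rewrite da db.
Qed.

Lemma polygon_base : polygon [:: 1; 1]%N [:: 0].
Proof.
have tri10 : tri 1 0 = 0.
  by rewrite tri_rot // -[RHS](tri0y 1); apply: tri_same_edge; rewrite // /same_edge.
(* The vertical edges are (0, 1) and (-1, 0); reversing either one gives again an edge of the
   triangle of class 0. *)
have infinite x y u v : odd_pair x y -> odd_pair u v -> same_edge x y u v ->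
    tri v (- u) = 0 -> ~~ same_edge u v 1 1 ->
    [/\ tri y (- x) \in [:: 0],
      {in sides [:: 1; 1]%N, forall s : nat * nat, ~~ same_edge x y s.1 s.2}
      & tri y (- x) != 0 \/ 0 = 0 :> R].
  move=> o o' e t0 ne; rewrite inE -{1}t0; split; last by right.
    by apply/eqP/tri_same_edge; rewrite ?odd_pair_rev // same_edge_rev.
  move=> s; rewrite inE => /eqP->; apply: contra ne; exact: same_edge_trans.
split=> //=.
- by move=> x; rewrite inE => /eqP->; rewrite -(tri0y 1) tri_even.
- by move=> a; rewrite !inE orbb => /eqP->.
- by move=> s; rewrite inE => /eqP->.
- move=> s; rewrite !inE => /eqP-> /=.
  rewrite -[X in _ == X]tri10; apply/eqP.
  by rewrite tri_rot //; apply: tri_same_edge; rewrite // /same_edge.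
- move=> x y o; rewrite inE => /eqP t0; rewrite t0.
  have side11 : (1, 1)%N \in sides [:: 1; 1]%N by rewrite inE.
  case: (tri_inj o _ (etrans t0 (esym (tri0y 1)))) => // e.
  + by right; apply: (infinite _ _ 0 1) => //; apply: not_same_edge.
  + by left; exists (1, 1)%N.
  + right; apply: (infinite _ _ (-1) 0) => //; last exact: not_same_edge.
    exact: tri0y.
Qed.

(** If a new edge were equivalent to an old one, the new class would already lie in [K], as the
    inner triangles at all old sides do. Within the new triangle, [odd_pair_form] keeps the edges
    apart. *)
Lemma polygon_insert (u v : seq nat) (a b : nat) (K : seq R) :
    polygon (u ++ a :: b :: v) K -> tri a b \notin K ->
  polygon (u ++ a :: (a + b)%N :: b :: v) (tri a b :: K).
Proof.
move=> P KN; set c := (a + b)%N.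
set S0 := sides (rcons u a); set S1 := sides (b :: v).
have [/polygon_gt0 pos /polygon_coprime cop] := (P, P).
have inner := polygon_inner P; have edge := polygon_edge P.
have dist := polygon_distinct P.
have old : sides (u ++ a :: b :: v) = S0 ++ (a, b) :: S1 by rewrite sides_cat.
have new : sides (u ++ a :: c :: b :: v) = S0 ++ (a, c) :: (c, b) :: S1.
  by rewrite sides_cat.
have memo s : (s \in sides (u ++ a :: b :: v)) = (s == (a, b)) || (s \in S0 ++ S1).
  by rewrite old !mem_cat inE orbCA.
have memn s : (s \in sides (u ++ a :: c :: b :: v)) =
    [|| s == (a, c), s == (c, b) | s \in S0 ++ S1].
  by rewrite new !mem_cat !inE; case: (s \in S0); rewrite ?orbT.
have ab_side : (a, b) \in sides (u ++ a :: b :: v) by rewrite memo eqxx.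
have cab : coprime a b := cop _ ab_side.
have cac : coprime a c by rewrite /coprime gcdnDl.
have ccb : coprime c b by rewrite /coprime gcdnC gcdnDr gcdnC.
have oab := coprime_odd_pair cab.
have oac := coprime_odd_pair cac.
have ocb := coprime_odd_pair ccb.
have cE : c%:Z = a%:Z + b%:Z by rewrite /c PoszD.
have iac : tri c (- a%:Z) = tri a b by rewrite cE tri_far_l.
have icb : tri b (- c%:Z) = tri a b by rewrite cE tri_far_r.
have oldN s : s \in sides (u ++ a :: b :: v) ->
    [/\ ~~ same_edge a b s.2 (- s.1%:Z), ~~ same_edge s.1 s.2 a c
      & ~~ same_edge s.1 s.2 c b].
  move=> s_old; have os := coprime_odd_pair (cop _ s_old).
  have si := inner _ s_old; split; apply: contra KN => e.
  - by rewrite (tri_same_edge _ _ e) // odd_pair_rev.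
  - by rewrite -iac -(tri_same_edge _ _ (same_edge_rev e)) // odd_pair_rev.
  - by rewrite -icb -(tri_same_edge _ _ (same_edge_rev e)) // odd_pair_rev.
have aN s : s \in S0 ++ S1 -> ~~ same_edge s.1 s.2 a b.
  move: dist; rewrite old pairwise_cat allrel_consr /=.
  case/andP=> /andP[/allP dl _] /andP[_ /andP[/allP dr _]].
  by rewrite mem_cat => /orP[/dl//|/dr]; rewrite same_edge_sym.
have par : (2 %| c%:Z)%Z = ((2 %| a%:Z)%Z == (2 %| b%:Z)%Z) by lia.
have edges_distinct x y x' y' : x * y' - y * x' =
    - (a%:Z * a%:Z + a%:Z * b%:Z + b%:Z * b%:Z) -> ~~ same_edge x y x' y'.
  by move=> e; apply: not_same_edge; rewrite e dvdz_opp odd_pair_form.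
have acb : ~~ same_edge a c c b.
  by apply: edges_distinct; rewrite cE; ring.
have newN s : s \in sides (u ++ a :: c :: b :: v) -> ~~ same_edge a b s.1 s.2.
  rewrite memn same_edge_sym => /or3P[/eqP->|/eqP->|/aN//] /=.
  - apply: contraNN KN; rewrite same_edge_sym => e.
    rewrite -iac -(tri_same_edge _ _ (same_edge_rev e)) ?odd_pair_rev //.
    exact: (inner _ ab_side).
  - apply: contraNN KN; rewrite same_edge_sym => e.
    rewrite -icb -(tri_same_edge _ _ (same_edge_rev e)) ?odd_pair_rev //.
    exact: (inner _ ab_side).
split.
- by rewrite /= KN (polygon_uniq P).
- by have := polygon_size P; rewrite !size_cat /= !addnS => ->.
- by move=> x; rewrite inE => /orP[/eqP->|/(polygon_even P)//]; exact: tri_even.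
- by rewrite inE (polygon_root P) orbT.
- move=> x; rewrite mem_cat !inE => x_in.
  have [->|ne] := eqVneq x c.
    by rewrite addn_gt0 pos // mem_cat mem_head orbT.
  by apply: pos; rewrite mem_cat !inE; move: x_in; rewrite (negPf ne).
- move=> s; rewrite memn => /or3P[/eqP->|/eqP->|s_in] //.
  by apply: cop; rewrite memo s_in orbT.
- move: dist; rewrite old new !pairwise_cat !allrel_consr /= acb.
  have sub0 s : s \in S0 -> s \in sides (u ++ a :: b :: v).
    by rewrite old mem_cat => ->.
  have sub1 s : s \in S1 -> s \in sides (u ++ a :: b :: v).
    by rewrite old mem_cat inE => ->; rewrite !orbT.
  case/andP=> /andP[_ d01] /andP[d0 /andP[_ d1]].
  rewrite d01 d0 d1 -!andbA !andbT /=.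
  apply/and4P; split; apply/allP => s s_in.
  + by have [] := oldN _ (sub0 _ s_in).
  + by have [] := oldN _ (sub0 _ s_in).
  + by rewrite same_edge_sym; have [] := oldN _ (sub1 _ s_in).
  + by rewrite same_edge_sym; have [] := oldN _ (sub1 _ s_in).
- move=> s; rewrite memn !inE => /or3P[/eqP->|/eqP->|s_in] /=.
  + by rewrite iac eqxx.
  + by rewrite icb eqxx.
  + by rewrite inner ?orbT // memo s_in orbT.
move=> x y oxy; rewrite inE => /orP[/eqP txy|Kxy].
  (* Edges of the new triangle: (a, b) is now interior, and the other two are the inner edges at the
     new sides. *)
  case: (tri_inj oxy oab txy) => e.
  - right; have tyx : tri y (- x) = tri b (- a%:Z).
      by apply: tri_same_edge (same_edge_rev e); rewrite odd_pair_rev.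
    have Kba := inner _ ab_side; rewrite tyx inE Kba orbT; split=> //.
      move=> s /newN; apply: contra; exact: same_edge_trans.
    by left; rewrite txy; apply: contraNneq KN => <-.
  - by left; exists (c, b); rewrite ?memn ?eqxx ?orbT //= cE opprD.
  - left; exists (a, c); rewrite ?memn ?eqxx //= -same_edge_opp.
    by rewrite opprK cE opprD.
(* Edges of the old triangles: only the inner edge at (a, b) changes its status, being now glued to
   the new triangle. *)
case: (edge _ _ oxy Kxy) => [[s s_old e]|[Kyx N_old neq]].
  move: s_old; rewrite memo => /orP[/eqP s_ab|s_in]; last first.
    by left; exists s; rewrite // memn s_in !orbT.
  move: e; rewrite s_ab /= => e; right.
  have e' : same_edge y (- x) a b by rewrite -same_edge_opp; exact: same_edge_rev.
  have tyx : tri y (- x) = tri a b.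
    by apply: tri_same_edge => //; rewrite odd_pair_rev.
  rewrite tyx inE eqxx; split=> //; last by left; apply: contraNneq KN => ->.
  move=> t t_in; apply/negP => /same_edge_rev et.
  have := same_edge_trans (odd_pair_rev oxy) e' et; apply/negP.
  move: t_in; rewrite memn => /or3P[/eqP->|/eqP->|t_in] /=.
  - by apply: edges_distinct; rewrite cE; ring.
  - by apply: edges_distinct; rewrite cE; ring.
  - by have [] := oldN t; rewrite ?memo ?t_in ?orbT.
right; rewrite inE Kyx orbT; split=> // s; rewrite memn.
case/or3P=> [/eqP->|/eqP->|s_in] /=.
- apply: contra KN => /same_edge_rev e.
  by rewrite -iac -(tri_same_edge _ _ e) // odd_pair_rev.
- apply: contra KN => /same_edge_rev e.
  by rewrite -icb -(tri_same_edge _ _ e) // odd_pair_rev.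
by apply: N_old; rewrite memo s_in orbT.
Qed.

(** * Termination by counting classes *)

Lemma polygon_size_le (e : seq nat) (K : seq R) : polygon e K -> (size K <= M)%N.
Proof.
move=> P; have := uniq_leq_size (polygon_uniq P) (polygon_even P).
by rewrite size_map size_iota.
Qed.

(** Each step enlarges [K], whose size never exceeds [M], so the steps must end at the goal. *)
Lemma polygon_saturate (inv goal : seq nat -> seq R -> Prop) :
    (forall e K, inv e K -> polygon e K) ->
    (forall e K, inv e K ->
      goal e K \/ exists e' K', inv e' K' /\ (size K < size K')%N) ->
  forall e K, inv e K -> exists e' K', inv e' K' /\ goal e' K'.
Proof.
move=> invP step e K; have [m] := ubnP (M - size K).
elim: m e K => // m IHm e K lt_m eK.
have [g|[e' [K' [eK' lt_K]]]] := step e K eK; first by exists e, K.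
apply: (IHm e' K') => //; rewrite -ltnS (leq_trans _ lt_m) // ltnS ltn_sub2l //.
exact: leq_trans lt_K (polygon_size_le (invP _ _ eK')).
Qed.

Lemma dvdz_small (x : int) : (N %| x)%Z -> `|x| < N%:Z -> x = 0.
Proof.
rewrite dvdzE /= => d lt_N; apply/eqP; rewrite -absz_eq0 -leqn0 leqNgt.
by apply/negP => /dvdn_leq/(_ d); lia.
Qed.

Lemma polygon_pos_side (e : seq nat) (K : seq R) (s : nat * nat) :
  polygon e K -> s \in sides e -> (0 < s.1)%N && (0 < s.2)%N.
Proof.
move=> /polygon_gt0 pos /mem_sides[u [v eq_e]].
by rewrite !pos // eq_e mem_cat !inE eqxx !orbT.
Qed.

Lemma trix0 (x : int) : odd_pair x 0 -> tri x 0 = 0.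
Proof. by move=> o; rewrite tri_rot // tri0y. Qed.

Lemma triNx (x : int) : odd_pair x (- x) -> tri x (- x) = 0.
Proof.
move=> o; rewrite tri_rot // (_ : - x - - x = 0); last by ring.
by rewrite trix0 //; move: o; rewrite /odd_pair; lia.
Qed.

Lemma tri_rev_subl (x y : int) : odd_pair x y -> tri (x - y) y = tri y (- x).
Proof.
move=> o; rewrite tri_rot; last by move: o; rewrite /odd_pair; lia.
by congr tri; ring.
Qed.

Lemma tri_rev_subr (x y : int) : odd_pair x y -> tri x (y - x) = tri y (- x).
Proof.
move=> o; rewrite -[RHS]tri_opp ?odd_pair_rev // opprK tri_rot; last first.
  by move: o; rewrite /odd_pair; lia.
rewrite tri_rot; last by move: o; rewrite /odd_pair; lia.
by congr tri; ring.
Qed.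

(** * Polygons all of whose outer triangles are covered *)

Lemma polygon_rev (e : seq nat) (K : seq R) (x y : int) :
    polygon e K -> {in sides e, forall s : nat * nat, tri s.1 s.2 \in K} ->
  odd_pair x y -> tri x y \in K -> tri y (- x) \in K.
Proof.
move=> P done o K_xy; case: (polygon_edge P o K_xy) => [[s s_in e_s]|[//]].
have os := coprime_odd_pair (polygon_coprime P s_in).
rewrite (tri_same_edge _ _ (same_edge_rev e_s)) ?odd_pair_rev // tri_opp //.
exact: done.
Qed.

(** Starting from class 0 and crossing one edge at a time, the walk passes through [tri k 1] for
    every k; the even k give all even residues. *)
Lemma polygon_full (e : seq nat) (K : seq R) :
    polygon e K -> {in sides e, forall s : nat * nat, tri s.1 s.2 \in K} ->
  {subset even_residues <= K}.
Proof.
move=> P done.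
have odd1 (x : int) : odd_pair x 1 by rewrite /odd_pair; lia.
have K1 (k : nat) : tri k 1 \in K.
  elim: k => [|k IHk]; first by rewrite tri0y (polygon_root P).
  rewrite -tri_opp //; apply: (polygon_rev P done); first exact: odd_pair_rev.
  by rewrite -tri_rev_subl // (_ : k.+1%:Z - 1 = k) //; lia.
move=> z /mapP[k _ ->]; rewrite -[X in X \in _](_ : tri (2 * k)%N 1 = _) //.
by rewrite /tri dvdzE /= dvdn_mulr // /slope divr1.
Qed.

Lemma polygon_full_size (e : seq nat) (K : seq R) :
    polygon e K -> {in sides e, forall s : nat * nat, tri s.1 s.2 \in K} ->
  size e = M.+1.
Proof.
move=> P done; rewrite (polygon_size P); congr _.+1; apply/eqP.
rewrite eqn_leq (polygon_size_le P) /=.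
have uniq_even : uniq even_residues.
  rewrite map_inj_in_uniq ?iota_uniq // => i j; rewrite !mem_iota /= => i_lt j_lt.
  move/(congr1 val); rewrite /= !val_Zp_nat // !modn_small; lia.
have := uniq_leq_size uniq_even (polygon_full P done).
by rewrite size_map size_iota.
Qed.

Lemma polygon_side_inj (e : seq nat) (K : seq R) (s t : nat * nat) :
    polygon e K -> s \in sides e -> t \in sides e ->
  same_edge s.1 s.2 t.1 t.2 -> s = t.
Proof.
move=> P /(nthP (0, 0)%N)[i i_lt <-] /(nthP (0, 0)%N)[j j_lt <-] e_st.
have /(pairwiseP (0, 0)%N) dist := polygon_distinct P.
have [lt_ij|lt_ji|-> //] := ltngtP i j.
  by have := dist _ _ i_lt j_lt lt_ij; rewrite e_st.
by have := dist _ _ j_lt i_lt lt_ji; rewrite same_edge_sym e_st.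
Qed.

Lemma same_edge_paired (s t : nat * nat) :
  same_edge s.1 s.2 t.2 (- t.1%:Z) = (N %| s.1 * t.1 + s.2 * t.2)%N.
Proof.
rewrite /same_edge -dvdz_opp -[RHS]/((N%:Z %| Posz (s.1 * t.1 + s.2 * t.2)%N)%Z).
by congr (_ %| _)%Z; rewrite PoszD !PoszM; ring.
Qed.

(** Since 4 divides N, no edge is equivalent to its own reversal, so the partner of a side is a
    different side. *)
Lemma odd_pair_sum_sq (a b : nat) : odd_pair a b -> ~~ (4 %| a * a + b * b)%N.
Proof.
rewrite /odd_pair => o; apply/negP => /dvdnP[k eq_k].
have form (c : nat) : exists i, c = (2 * i)%N \/ c = (2 * i + 1)%N.
  by exists (c %/ 2)%N; lia.
have [i [ha|ha]] := form a; have [j [hb|hb]] := form b.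
all: by move: eq_k o; rewrite ha hb; clear; lia.
Qed.

(** A side with covered outer triangle is not glued inside the polygon, so by [polygon_edge] it is
    equivalent to the inner edge at some side, which is its partner. *)
Lemma polygon_paired (e : seq nat) (K : seq R) (s : nat * nat) :
    polygon e K -> s \in sides e -> tri s.1 s.2 \in K ->
  exists! t, t \in sides e /\ paired N s t.
Proof.
move=> P s_in K_s; have os := coprime_odd_pair (polygon_coprime P s_in).
case: (polygon_edge P os K_s) => [[t t_in e_st]|[_ /(_ _ s_in)]]; last first.
  by rewrite same_edge_refl.
exists t; split=> [|t' [t'_in /andP[_]]].
  split=> //; rewrite /paired -same_edge_paired e_st andbT.
  apply: contraL e_st => /eqP <-; rewrite same_edge_paired.
  apply: contra (odd_pair_sum_sq os); apply: dvdn_trans.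
  by have [h eM _] := M_even; rewrite N_M eM mulnA dvdn_mulr.
rewrite -same_edge_paired => e_st'.
apply: (polygon_side_inj P) => //.
by have := same_edge_trans os e_st e_st'; rewrite /same_edge; congr (_ %| _)%Z; ring.
Qed.

Lemma size_sides (e : seq nat) : size (sides e) = (size e).-1.
Proof. by rewrite size_zip size_behead; apply/minn_idPr/leq_pred. Qed.

(** The triangle at the edge (M, 1) is its own neighbour across that edge, because N divides M^2,
    and its class is not 0. So the edge is not glued inside the polygon and is the inner edge at
    some side [s], where N divides M s.1 + s.2 with s.1 odd. This forces s.2 = M. All pairs (odd, M)
    are equivalent edges, so no other side ends in [M]. *)
Lemma polygon_top (e : seq nat) (K : seq R) :
    polygon e K -> {in sides e, forall s : nat * nat, tri s.1 s.2 \in K} ->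
    {in e, forall a, (a <= M)%N} -> nth 0%N e 0 = 1%N ->
  exists! j : 'I_(size e), nth 0%N e j = M.
Proof.
move=> P done le e0.
have [h eM h_gt0] := M_even.
have oM : odd_pair M 1 by rewrite /odd_pair; lia.
have triM : tri M 1 = M%:R by rewrite /tri dvdzE /= eM dvdn_mulr // /slope divr1.
have K_M : tri M 1 \in K.
  rewrite triM; apply: (polygon_full P done).
  apply/mapP; exists h; last by rewrite eM.
  by rewrite mem_iota; lia.
have loop : tri 1 (- M%:Z) = tri M 1.
  rewrite tri_rot ?odd_pair_rev //; apply: tri_same_edge => //.
    exact: odd_pair_rot (odd_pair_rev oM).
  by apply/dvdzP; exists (- h%:Z); rewrite N_M eM !PoszM; ring.
case: (polygon_edge P oM K_M) => [[s s_in e_s]|[_ _]]; last first.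
  rewrite loop eqxx => -[//|]; rewrite triM => /(congr1 val).
  by rewrite /= val_Zp_nat // modn_small; lia.
have s2_odd t : t \in sides e -> t.2 = M -> ~~ (2 %| t.1%:Z)%Z.
  move=> t_in t2; have := coprime_odd_pair (polygon_coprime P t_in).
  by rewrite /odd_pair t2 eM; clear; lia.
have s2M : s.2 = M.
  have os := coprime_odd_pair (polygon_coprime P s_in).
  have /andP[_ s2_gt0] := polygon_pos_side P s_in.
  have s2_le : (s.2 <= M)%N.
    have [u [v eq_e]] := mem_sides s_in.
    by apply: le; rewrite eq_e mem_cat !inE eqxx !orbT.
  have : (N %| M%:Z * s.1 + 1 * s.2)%Z.
    by move: e_s; rewrite /same_edge -dvdz_opp; congr (_ %| _)%Z; ring.
  case/dvdzP => k eq_k.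
  have odd1 : ~~ (2 %| s.1%:Z)%Z.
    apply/negP => d1; move: os; rewrite /odd_pair d1 /=.
    suff -> : (2 %| s.2%:Z)%Z by [].
    by move: eq_k; rewrite N_M eM; clear; lia.
  have [i eq_i] : exists i, s.1 = (2 * i + 1)%N.
    by exists (s.1 %/ 2)%N; move: odd1; clear; lia.
  have d2 : (N %| s.2%:Z - M%:Z)%Z.
    apply/dvdzP; exists (k - i%:Z - 1); rewrite mulrBl mulrBl -eq_k eq_i N_M.
    by rewrite PoszD !PoszM; ring.
  by have := dvdz_small d2; move: s2_gt0 s2_le N_M; clear; lia.
have side_nth i : (i.+1 < size e)%N ->
    (i < size (sides e))%N /\
    nth (0, 0)%N (sides e) i = (nth 0%N e i, nth 0%N e i.+1).
  move=> lt_i; have lt_i' : (i < size (sides e))%N.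
    by rewrite size_sides ltn_predRL.
  by rewrite nth_zip_cond lt_i' nth_behead.
have [i i_lt eq_s] := nthP (0, 0)%N s_in.
have i1_lt : (i.+1 < size e)%N by rewrite -ltn_predRL -size_sides.
exists (Ordinal i1_lt); split=> [|[j j_lt] /= eq_j].
  by have [_] := side_nth _ i1_lt; rewrite eq_s -s2M => ->.
(* The first term is 1, not [M], so any index with value [M] is the right end of a side. *)
apply: val_inj => /=; case: j j_lt eq_j => [|j] j_lt eq_j.
  by move: eq_j; rewrite e0; lia.
have [j_lt' sj] := side_nth _ j_lt.
have t_in : nth (0, 0)%N (sides e) j \in sides e by rewrite mem_nth.
have st : s = nth (0, 0)%N (sides e) j.
  apply: (polygon_side_inj P) => //; rewrite /same_edge.
  have := s2_odd _ s_in s2M; have := s2_odd _ t_in.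
  rewrite sj /= eq_j s2M => /(_ erefl) o1 o2; apply/dvdzP.
  have /dvdzP[k eq_k] : (2 %| s.1%:Z - (nth 0%N e j)%:Z)%Z.
    by move: o1 o2; move: (nth 0%N e j)%:Z s.1%:Z => z w; clear; lia.
  by exists k; rewrite N_M PoszM mulrA -eq_k; ring.
have uniq_sides : uniq (sides e).
  apply/(uniqP (0, 0)%N) => k l k_lt l_lt eq_kl.
  have /(pairwiseP (0, 0)%N) dist := polygon_distinct P.
  have [lt_kl|lt_lk|//] := ltngtP k l.
    by have := dist _ _ k_lt l_lt lt_kl; rewrite eq_kl same_edge_refl.
  by have := dist _ _ l_lt k_lt lt_lk; rewrite eq_kl same_edge_refl.
by congr _.+1; apply/eqP; rewrite -(nth_uniq (0, 0)%N i_lt j_lt' uniq_sides) eq_s st.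
Qed.

(** * The polygon of the Farey sequence of order r *)

Variable r : nat.
Hypothesis r_le : (r * r <= N)%N.
Hypothesis r_gt : (N < r.+1 * r.+1)%N.

Let r_ge2 : (2 <= r)%N.
Proof.
have [h eM h_gt0] := M_even; rewrite leqNgt; apply/negP => r_lt.
by move: r_gt; rewrite N_M eM; case: r r_lt => [|[|]] //; lia.
Qed.

Definition farey_polygon (e : seq nat) (K : seq R) : Prop :=
  [/\ polygon e K, {in e, forall a, (a <= r)%N}
    & {in sides e, forall s : nat * nat, (r < s.1 + s.2)%N}].

Lemma side_le (e : seq nat) (s : nat * nat) :
  {in e, forall a, (a <= r)%N} -> s \in sides e -> (s.1 <= r)%N && (s.2 <= r)%N.
Proof.
move=> le /mem_sides[u [v eq_e]].
by rewrite !le // eq_e mem_cat !inE eqxx !orbT.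
Qed.

Lemma farey_polygon_exists :
  exists e K, farey_sequence e /\ farey_polygon e K.
Proof.
pose inv e K := [/\ polygon e K, {in e, forall a, (a <= r)%N} & farey_sequence e].
pose goal e (_ : seq R) := {in sides e, forall s : nat * nat, (r < s.1 + s.2)%N}.
have [] // := @polygon_saturate inv goal _ _ [:: 1; 1]%N [:: 0].
- by move=> e K [].
- move=> e K [P le far].
  have [/allP|/allPn[[a b] ab_side /=]] :=
    boolP (all (fun s => r < s.1 + s.2)%N (sides e)); first by left.
  rewrite -leqNgt => ab_le; right.
  have [u [v /= eq_e]] := mem_sides ab_side.
  have N_K : tri a b \notin K.
    have oab : odd_pair a b by apply/coprime_odd_pair/(polygon_coprime P ab_side).
    apply/negP => K_ab; have := polygon_edge P oab K_ab.
    case=> [[[c d] cd_side /=]|[_ /(_ _ ab_side)]]; last first.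
      by rewrite same_edge_refl.
    have /= /andP[c_le d_le] := side_le le cd_side.
    have /= /andP[a_gt0 b_gt0] := polygon_pos_side P ab_side.
    have /= /andP[c_gt0 d_gt0] := polygon_pos_side P cd_side.
    have /= co := polygon_coprime P cd_side.
    (* From a + b <= r follows a c + b d <= r^2 <= N, with equality only for c = d = r. Otherwise
       the sum lies strictly between 0 and N. *)
    have [[cr dr]|lt] : (c = r /\ d = r) \/ (a * c + b * d < N)%N by nia.
      by move: co; rewrite cr dr /coprime gcdnn; lia.
    by move/dvdz_small; nia.
  exists (u ++ a :: (a + b)%N :: b :: v), (tri a b :: K); split=> //.
  split; first by apply: polygon_insert; rewrite -?eq_e.
    move=> x; rewrite mem_cat !inE => x_in.
    have [->//|ne] := eqVneq x (a + b)%N.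
    by apply: le; rewrite eq_e mem_cat !inE; move: x_in; rewrite (negPf ne).
  by apply: Obtained_insert; rewrite -eq_e.
- split; [exact: polygon_base|move=> a|exact: Obtained_refl].
  by rewrite !inE orbb => /eqP->; lia.
by move=> e [K [[P le far] big]]; exists e, K.
Qed.

(** Euclidean descent: the triangle on the other side of (x, y) has smaller entries and lies in [K].
    If the common edge were the inner edge at a side (a, b), smallness would turn the congruence
    into x b = y a, whence x + y >= a + b > r. *)
Lemma farey_polygon_pos (e : seq nat) (K : seq R) (x y : nat) :
    farey_polygon e K -> odd_pair x y -> (0 < x)%N -> (0 < y)%N ->
  (x + y <= r)%N -> tri x y \in K.
Proof.
move=> [P le big]; have [m] := ubnP (x + y); elim: m x y => // m IHm x y lt_m.
move=> o x_gt0 y_gt0 xy_le.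
have rev : tri y (- x%:Z) \in K.
  have [lt_xy|lt_yx|exy] := ltngtP x y.
  - rewrite -tri_rev_subr // subzn 1?ltnW //.
    apply: IHm; [lia| |lia|lia|lia].
    by rewrite -subzn 1?ltnW //; move: o; rewrite /odd_pair; clear; lia.
  - rewrite -tri_rev_subl // subzn 1?ltnW //.
    apply: IHm; [lia| |lia|lia|lia].
    by rewrite -subzn 1?ltnW //; move: o; rewrite /odd_pair; clear; lia.
  - rewrite exy triNx ?(polygon_root P) //.
    by move: o; rewrite exy /odd_pair; clear; lia.
case: (polygon_edge P (odd_pair_rev o) rev) => [[[a b] ab_side /=]|[]]; last first.
  by rewrite tri_opp.
have /= /andP[a_le b_le] := side_le le ab_side.
have /= /andP[a_gt0 b_gt0] := polygon_pos_side P ab_side.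
have /= co := polygon_coprime P ab_side.
have /= ab_big := big _ ab_side.
rewrite /same_edge => /dvdz_small eq_xy.
have {}eq_xy : (x * b = y * a)%N by have := eq_xy; nia.
have /dvdnP[k xk] : (a %| x)%N by rewrite -(Gauss_dvdl _ co) eq_xy dvdn_mull.
have : y = (k * b)%N by apply/eqP; rewrite -(eqn_pmul2r a_gt0) -eq_xy xk mulnAC.
case: k xk => [|k] xk yk; first by rewrite xk in x_gt0.
by move: xy_le ab_big; rewrite xk yk -mulnDr mulSn; clear; lia.
Qed.

(** Three nonzero numbers with sum 0 include two of the same sign; a rotation and a change of sign
    reduce to the positive case. *)
Lemma farey_polygon_small (e : seq nat) (K : seq R) (x y : int) :
    farey_polygon e K -> odd_pair x y ->
  `|x| <= r%:Z -> `|y| <= r%:Z -> `|x + y| <= r%:Z -> tri x y \in K.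
Proof.
move=> F; have [P _ _] := F.
have pos u v : odd_pair u v -> 0 < u -> 0 < v -> u + v <= r%:Z -> tri u v \in K.
  by case: u => // u; case: v => // v o u0 v0 uv; apply: (farey_polygon_pos F).
have same u v : odd_pair u v -> 0 < u * v -> `|u + v| <= r%:Z -> tri u v \in K.
  move=> o uv le; have [u0|u0|u0] := ltgtP u 0; last by rewrite u0 mul0r in uv.
    rewrite -tri_opp //; apply: pos; first by move: o; rewrite /odd_pair; lia.
    - by rewrite oppr_gt0.
    - by rewrite oppr_gt0 -(nmulr_rgt0 _ u0).
    - by lia.
  by rewrite pmulr_rgt0 // in uv; apply: pos => //; lia.
move=> o x_le y_le xy_le.
have [x0|x0] := eqVneq x 0; first by rewrite x0 tri0y (polygon_root P).
have [y0|y0] := eqVneq y 0; first by rewrite y0 trix0 -?y0 // (polygon_root P).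
have [xy|xy] := ltP 0 (x * y); first exact: same.
have o1 := odd_pair_rot o; have o2 := odd_pair_rot o1.
have [yz|yz] := ltP 0 (y * (- x - y)).
  by rewrite tri_rot //; apply: same => //; rewrite addrCA subrr addr0 normrN.
have [z0|z0] := eqVneq (- x - y) 0.
  by rewrite tri_rot // z0 trix0 -?z0 // (polygon_root P).
rewrite tri_rot // tri_rot //; apply: same => //; last by lia.
by nia.
Qed.

(** * Labels *)

(* Equivalently, 2 (p, q) is a primitive vector of the lattice of all (u, v) with
   x u + y v = 0 mod N.  The last two conditions bound by r the two smaller
   entries of the triangle with entries 2p, 2q and 2|p - q|. *)
Definition label (x y p q : int) : bool :=
  [&& 0 < p, 0 < q, (N %| x * p + y * q - M%:Z)%Z, (gcdz p q %| M%:Z)%Z,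
      `|2 * (p - q)| <= r%:Z & (2 * p <= r%:Z) || (2 * q <= r%:Z)].

Lemma label_swap (x y p q : int) : label x y p q -> label y x q p.
Proof.
rewrite /label => /and5P[-> -> d g /andP[le mn]].
by rewrite [y * q + _]addrC d gcdzC g -normrN -mulrN opprB le orbC mn.
Qed.

(** The window for z1 has length x, the spacing of the points on the line. Having z2 < 0 or z1 > s
    would contradict s^2 <= m, and z2 > s would contradict m < (s + 1)^2. *)
Lemma chord_bounds (x y z1 z2 s m : int) :
    s < x -> 0 < y -> y <= s -> x - y <= s ->
    s * s <= m -> m < (s + 1) * (s + 1) ->
    - s <= z1 -> z1 < x - s -> x * z2 - y * z1 = m ->
  (`|z1| <= s) && (`|z2| <= s).
Proof.
move=> lt_x y_gt0 y_le xy_le m_le m_lt z1_ge z1_lt eq_m.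
have z2_ge : 0 <= z2.
  by rewrite leNgt; apply/negP => ?; nia.
have z2_le : z2 <= s.
  by rewrite leNgt; apply/negP => ?; nia.
have z1_le : z1 <= s.
  by rewrite leNgt; apply/negP => ?; nia.
lia.
Qed.

Lemma label_odd_multiple (x y p q : int) : label x y p q ->
  exists2 j, x * p + y * q = M%:Z * j & ~~ (2 %| j)%Z.
Proof.
case/and3P=> _ _ /andP[/dvdzP[i eq_i] _]; exists (1 + 2 * i); last by lia.
by rewrite -[LHS](subrK M%:Z) eq_i N_M PoszM; ring.
Qed.

(* The vectors z of the lattice with det (2 (p, q), z) = N are odd and spaced by
   2 (p, q); the chord that the line det (2 (p, q), z) = N cuts out of the square
   [-r, r]^2 is long enough to contain one of them. *)
Lemma label_chord (x y p q : int) :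
    odd_pair x y -> label x y p q -> (r%:Z < 2 * p) || (r%:Z < 2 * q) ->
  exists z1 z2, [/\ odd_pair z1 z2, (N %| x * z1 + y * z2)%Z,
                    `|z1| <= r%:Z & `|z2| <= r%:Z].
Proof.
wlog big_p : x y p q / r%:Z < 2 * p.
  move=> wl o l /orP[big|big]; first by apply: (wl x y p q); rewrite ?big.
  have [|||z1 [z2 [oz dz le1 le2]]] := wl y x q p big.
  - by move: o; rewrite /odd_pair andbC.
  - exact: label_swap.
  - by rewrite big.
  exists z2, z1; split=> //.
    by move: oz; rewrite /odd_pair andbC.
  by rewrite addrC.
move=> o l _; have [j eq_j odd_j] := label_odd_multiple l.
case/and5P: l => p_gt0 q_gt0 _ dvd_g /andP[pq_le min_le].
have [s0 [t0 eq_g]] := Bezoutz p q.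
have co : coprimez j (2 * gcdz p q).
  have co2 : coprimez j 2.
    by rewrite coprimezE coprime_sym coprime2n; move: odd_j; clear; lia.
  rewrite coprimezMr co2 (coprimez_dvdr dvd_g) //.
  by rewrite coprimezE M_def coprimeXr // -[2%N]/(`|2%:Z|)%N -coprimezE.
have /coprimezP[[u w] /= eq_uw] := co.
pose s : int := w * s0; pose t : int := - (w * t0).
have eq1 : u * j + 2 * (p * s - q * t) = 1.
  by apply: etrans eq_uw; rewrite -eq_g /s /t; ring.
have odd_u : ~~ (2 %| u)%Z.
  by apply/negP => /dvdzP[k ek]; move: eq1; rewrite ek; clear; lia.
(* This vector is u (- y, x) plus a multiple of N, hence orthogonal to (x, y) modulo N; [eq1] makes
   its determinant with 2 (p, q) equal to N. *)
pose z1 : int := N%:Z * t - u * y; pose z2 : int := u * x + N%:Z * s.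
have N2M : N%:Z = 2 * M%:Z by rewrite N_M PoszM.
have det : 2 * p * z2 - 2 * q * z1 = N%:Z.
  transitivity (u * 2 * (x * p + y * q) + N%:Z * (2 * (p * s - q * t))).
    by rewrite /z1 /z2; ring.
  transitivity (N%:Z * (u * j + 2 * (p * s - q * t))); last by rewrite eq1 mulr1.
  by rewrite eq_j N2M; ring.
(* Subtracting [i] times 2 (p, q) moves z1 into the window from - r to 2 p - r. *)
pose i : int := divz (z1 + r%:Z) (2 * p).
have eqi : z1 + r%:Z = i * (2 * p) + modz (z1 + r%:Z) (2 * p) := divz_eq _ _.
have p2 : 2 * p != 0 by move: p_gt0; clear; lia.
have ge0 := modz_ge0 (z1 + r%:Z) p2.
have lt2 : modz (z1 + r%:Z) (2 * p) < 2 * p.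
  by have := ltz_mod (z1 + r%:Z) p2; rewrite ger0_norm //; move: p_gt0; clear; lia.
exists (z1 - i * (2 * p)), (z2 - i * (2 * q)).
have bnd : (`|z1 - i * (2 * p)| <= r%:Z) && (`|z2 - i * (2 * q)| <= r%:Z).
  apply: (@chord_bounds (2 * p) (2 * q) _ _ _ N%:Z).
  - by [].
  - by move: q_gt0; clear; lia.
  - by move: min_le big_p; clear; lia.
  - by move: pq_le; clear; lia.
  - by rewrite -PoszM lez_nat.
  - by rewrite -PoszD addn1 -PoszM ltz_nat.
  - by move: eqi ge0; clear; lia.
  - by move: eqi lt2; clear; lia.
  - by rewrite -det; ring.
case/andP: bnd => b1 b2; split=> //.
  have h1 : (2 %| z1 - i * (2 * p))%Z = (2 %| z1)%Z by clear; lia.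
  have h2 : (2 %| z2 - i * (2 * q))%Z = (2 %| z2)%Z by clear; lia.
  rewrite /odd_pair h1 h2 /z1 /z2 N2M.
  apply/negP => /andP[d1 d2]; move: o; rewrite /odd_pair => /negP[].
  have d3 : (2 %| u * y)%Z by move: d1; clear; lia.
  have d4 : (2 %| u * x)%Z by move: d2; clear; lia.
  have co2 : coprimez 2 u by rewrite coprimezE coprime2n; move: odd_u; clear; lia.
  by rewrite -(Gauss_dvdzr x co2) -(Gauss_dvdzr y co2) d3 d4.
apply/dvdzP; exists (x * t + y * s - i * j).
transitivity (N%:Z * (x * t + y * s) - 2 * i * (x * p + y * q)).
  by rewrite /z1 /z2; ring.
by rewrite eq_j N2M; ring.
Qed.

(** * Extending the polygon along labelled sides *)

Section Saturation.

Variables (e0 : seq nat) (K0 : seq R).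
Hypothesis F0 : farey_polygon e0 K0.

(** The edge (x, y) is equivalent to (z2, - z1). According to the signs, z1 + z2 or z2 - z1 is
    small, so one of its two triangles has all entries bounded by r. *)
Lemma tri_orth_small (x y z1 z2 : int) :
    odd_pair x y -> odd_pair z1 z2 -> (N %| x * z1 + y * z2)%Z ->
    `|z1| <= r%:Z -> `|z2| <= r%:Z ->
  if z1 * z2 <= 0 then tri y (- x) \in K0 else tri x y \in K0.
Proof.
move=> o oz d le1 le2.
have e : same_edge x y z2 (- z1).
  by rewrite /same_edge -dvdz_opp; congr (_ %| _)%Z: d; ring.
case: ifPn => [np|]; last rewrite -ltNge => pz.
  rewrite (tri_same_edge _ _ (same_edge_rev e)) ?odd_pair_rev // tri_opp //.
  by apply: (farey_polygon_small F0) => //; move: np le1 le2; clear; nia.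
rewrite (tri_same_edge _ _ e) ?odd_pair_rev //.
apply: (farey_polygon_small F0); rewrite ?odd_pair_rev ?normrN //.
by move: pz le1 le2; clear; nia.
Qed.

Lemma label_small (x y p q : int) :
    odd_pair x y -> label x y p q -> (r%:Z < 2 * p) || (r%:Z < 2 * q) ->
  (tri x y \in K0) || (tri y (- x) \in K0).
Proof.
move=> o l big; have [z1 [z2 [oz d le1 le2]]] := label_chord o l big.
by have := tri_orth_small o oz d le1 le2; case: ifP => _ ->; rewrite ?orbT.
Qed.

Lemma parity_shift (a b x y : int) : odd_pair a b -> odd_pair x y ->
  (2 %| a * x + b * y)%Z -> (2 %| x - b)%Z && (2 %| y + a)%Z.
Proof.
have form (z : int) : exists i, z = 2 * i \/ z = 2 * i + 1.
  by exists (divz z 2); lia.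
have [i [->|->]] := form a; have [j [->|->]] := form b.
all: have [k [->|->]] := form x; have [l [->|->]] := form y.
all: by rewrite /odd_pair => o1 o2 /dvdzP[c e]; move: o1 o2 e; clear; lia.
Qed.

(** If 2 p and 2 q both exceeded r, then N = a (2 p) + b (2 q) >= (a + b) (r + 1) >= (r + 1)^2 >
    N. *)
Lemma label_even (a b : nat) (x y : int) :
    (0 < a)%N -> (0 < b)%N -> (r < a + b)%N ->
    a%:Z * x + b%:Z * y = N%:Z -> (2 %| x)%Z -> (2 %| y)%Z ->
    0 < x -> 0 < y -> `|x - y| <= r%:Z ->
  exists p q, label a b p q.
Proof.
move=> a_gt0 b_gt0 ab_big eq_N /dvdzP[p ex] /dvdzP[q ey]; subst x y.
move=> p_gt0 q_gt0 le.
exists p, q; have eq_M : a%:Z * p + b%:Z * q = M%:Z.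
  apply: (@mulfI _ (2 : int)) => //.
  by transitivity N%:Z; [rewrite -eq_N; ring|rewrite N_M PoszM].
rewrite /label eq_M subrr dvdz0 -eq_M rpredD ?dvdz_mull ?dvdz_gcdl ?dvdz_gcdr //=.
apply/and4P; split; try by move: p_gt0 q_gt0 le; clear; lia.
have : a%:Z * p * 2 + b%:Z * q * 2 < (r%:Z + 1) * (r%:Z + 1).
  rewrite -mulrDl eq_M mulrC -(PoszM 2) -N_M -PoszD addn1 -PoszM ltz_nat.
  exact: r_gt.
move=> lt; case: leP => // p_big; case: leP => // q_big.
have ap : a%:Z * (r%:Z + 1) <= a%:Z * p * 2.
  by rewrite -mulrA ler_wpM2l //; move: p_big; clear; lia.
have bq : b%:Z * (r%:Z + 1) <= b%:Z * q * 2.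
  by rewrite -mulrA ler_wpM2l //; move: q_big; clear; lia.
have : (r%:Z + 1) * (r%:Z + 1) <= (a%:Z + b%:Z) * (r%:Z + 1).
  by rewrite ler_wpM2r //; move: ab_big; clear; lia.
by move: lt ap bq; clear; lia.
Qed.

(* Solutions of a x + b y = N are spaced by (b, - a) and are alternately even and
   odd vectors.  Since a + b < 2 r, one of them satisfies |x - y| < r; it is even,
   or a small odd vector, or has an even neighbour with |x - y| <= r. *)
Lemma farey_side_label (s : nat * nat) : s \in sides e0 ->
  tri s.1 s.2 \in K0 \/ exists p q, label s.1 s.2 p q.
Proof.
move=> s_in; have [P le big] := F0; have /= ab_big := big _ s_in.
have /= /andP[a_le b_le] := side_le le s_in.
have /= /andP[a_gt0 b_gt0] := polygon_pos_side P s_in.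
have /= co := polygon_coprime P s_in.
move: {s_in} s.1 s.2 a_le b_le a_gt0 b_gt0 co ab_big => a b.
move=> a_le b_le a_gt0 b_gt0 co ab_big; have o := coprime_odd_pair co.
have /coprimezP[[u v] /= eq_uv] : coprimez a b by [].
have ab_lt : (a + b < 2 * r)%N.
  have [ar|] := eqVneq a r; last by lia.
  have [br|] := eqVneq b r; last by lia.
  by move: co; rewrite ar br /coprime gcdnn; move: r_ge2; clear; lia.
pose c : int := a%:Z + b%:Z; have c0 : c != 0 by rewrite /c; lia.
pose x0 : int := N%:Z * u; pose y0 : int := N%:Z * v; pose k : int := r%:Z - 1.
(* The difference x - y changes by a + b < 2 r from one solution to the next, so it can be brought
   between 1 - r and r - 1. *)
pose j : int := divz (x0 - y0 + k) c.
have eqj : x0 - y0 + k = j * c + modz (x0 - y0 + k) c := divz_eq _ _.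
have ge0 := modz_ge0 (x0 - y0 + k) c0.
have ltc : modz (x0 - y0 + k) c < c.
  by have := ltz_mod (x0 - y0 + k) c0; rewrite ger0_norm // /c; lia.
pose x : int := x0 - j * b%:Z; pose y : int := y0 + j * a%:Z.
have d_lt : `|x - y| < r%:Z.
  have -> : x - y = (x0 - y0 + k) - j * c - k by rewrite /x /y /c; ring.
  by rewrite eqj /k; move: ge0 ltc ab_lt; rewrite /c; clear; lia.
have eqN : a%:Z * x + b%:Z * y = N%:Z.
  transitivity (N%:Z * (u * a%:Z + v * b%:Z)); last by rewrite eq_uv mulr1.
  by rewrite /x /y /x0 /y0; ring.
have r1 : r%:Z * r%:Z <= N%:Z by rewrite -PoszM lez_nat.
have r2 : N%:Z < (r%:Z + 1) * (r%:Z + 1).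
  by rewrite -PoszD addn1 -PoszM ltz_nat.
have even_N : (2 %| a%:Z * x + b%:Z * y)%Z by rewrite eqN N_M PoszM dvdz_mulr.
clearbody x y; clear x0 y0 k j eqj ge0 ltc c c0 u v eq_uv.
have x_gt0 : 0 < x by rewrite ltNge; apply/negP => ?; nia.
have y_gt0 : 0 < y by rewrite ltNge; apply/negP => ?; nia.
have [ev|oz] := boolP ((2 %| x)%Z && (2 %| y)%Z).
  by right; case/andP: ev => ex ey; apply: (label_even _ _ _ eqN); rewrite // ltW.
(* Modulo 2 the odd vector (x, y) equals (b, a), so its neighbours (x + b, y - a) and (x - b, y + a)
   are even. *)
have [par_x par_y] := andP (parity_shift o oz even_N).
have [x_le|x_big] := leP x r%:Z.
  have [y_le|y_big] := leP y r%:Z.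
    have xy : (x * y <= 0) = false by apply/negbTE; rewrite -ltNge mulr_gt0.
    left; have := @tri_orth_small a b x y o oz; rewrite eqN dvdzz xy.
    by apply=> //; move: x_gt0 y_gt0 x_le y_le; clear; lia.
  right; apply: (@label_even a b (x + b%:Z) (y - a%:Z)) => //.
  - by rewrite -eqN; ring.
  - by move: par_x; clear; lia.
  - by move: par_y; clear; lia.
  - by move: x_gt0; clear; lia.
  - by move: y_big a_le; clear; lia.
  - have : - r%:Z <= y - x - (a%:Z + b%:Z).
      by rewrite leNgt; apply/negP => ?; clear par_x par_y even_N; nia.
    by move: d_lt; clear; lia.
have y_le : y <= r%:Z by rewrite leNgt; apply/negP => ?; nia.
right; apply: (@label_even a b (x - b%:Z) (y + a%:Z)) => //.
- by rewrite -eqN; ring.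
- by move: x_big b_le; clear; lia.
- by move: y_gt0; clear; lia.
have : - r%:Z <= x - y - (a%:Z + b%:Z).
  by rewrite leNgt; apply/negP => ?; clear par_x par_y even_N; nia.
by move: d_lt; clear; lia.
Qed.

(** Passing to the neighbouring triangle preserves the value x p + y q, and the bounds on p and q
    are what the new label needs. *)
Lemma label_subr (x y p q : int) : label x y p q ->
  2 * p <= r%:Z -> 2 * q <= r%:Z -> label x (y - x) (p + q) q.
Proof.
rewrite /label => /and5P[p_gt0 q_gt0 d dg _] p_le q_le.
rewrite q_gt0 addr_gt0 // addrK q_le orbT gcdzC gcdzDr gcdzC dg.
rewrite [X in (_ %| X - _)%Z](_ : _ = x * p + y * q); last by ring.
by rewrite d /=; move: p_le p_gt0; clear; lia.
Qed.

Lemma label_subl (x y p q : int) : label x y p q ->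
  2 * p <= r%:Z -> 2 * q <= r%:Z -> label (x - y) y p (p + q).
Proof.
move=> /label_swap l p_le q_le; apply: label_swap; rewrite [p + q]addrC.
exact: label_subr.
Qed.

(** Equivalent edges differ by an odd factor modulo N, and such a factor fixes [M] modulo N = 2
    M. *)
Lemma label_same_edge (x y u v p q : int) :
    odd_pair x y -> odd_pair u v -> same_edge x y u v ->
  label x y p q -> label u v p q.
Proof.
move=> o o' e; rewrite /label => /and5P[-> -> d -> ->]; rewrite !andbT /=.
have [px py] := same_edge_parity o o' e.
have NM k : (2 %| k)%Z -> (N %| M%:Z * k)%Z.
  by case/dvdzP => i ->; apply/dvdzP; exists i; rewrite N_M PoszM; ring.
move: (o); rewrite /odd_pair negb_and => /orP[] ox; rewrite -(odd_gauss _ ox).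
  have -> : x * (u * p + v * q - M%:Z) = u * (x * p + y * q - M%:Z)
      + (x * v - y * u) * q + M%:Z * (u - x) by ring.
  apply: rpredD; last by apply: NM; move: px; clear; lia.
  by apply: rpredD; [apply: dvdz_mull|apply: dvdz_mulr].
have -> : y * (u * p + v * q - M%:Z) = v * (x * p + y * q - M%:Z)
    - (x * v - y * u) * p + M%:Z * (v - y) by ring.
apply: rpredD; last by apply: NM; move: py; clear; lia.
by apply: rpredB; [apply: dvdz_mull|apply: dvdz_mulr].
Qed.

(** Crossing edges increases p + q. By [label_small] the walk cannot reach a label that is too large
    to continue, so it stops at an edge whose other triangle is in [K], and this edge is a side. *)
Lemma labelled_side_exists (e : seq nat) (K : seq R) (x y p q : int) :
    polygon e K -> {subset K0 <= K} ->
    odd_pair x y -> label x y p q -> tri x y \notin K ->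
  exists2 s, s \in sides e &
    tri s.1 s.2 \notin K /\ exists p' q', label s.1 s.2 p' q'.
Proof.
move=> P sub; have [m] := ubnP (absz (3 * r%:Z - (p + q))%R).
elim: m x y p q => // m IHm x y p q lt_m o l N_K.
have [rev|N_rev] := boolP (tri y (- x) \in K).
  case: (polygon_edge P (odd_pair_rev o) rev) => [[s s_side e_s]|[]]; last first.
    by rewrite tri_opp // (negPf N_K).
  have os := coprime_odd_pair (polygon_coprime P s_side).
  have e' : same_edge x y s.1 s.2.
    by move: e_s; rewrite /same_edge; congr (_ %| _)%Z; ring.
  exists s; rewrite // -(tri_same_edge o os e'); split=> //.
  by exists p, q; apply: label_same_edge l.
have [big|] := boolP ((r%:Z < 2 * p) || (r%:Z < 2 * q)).
  case/orP: (label_small o l big) => /sub K_in; first by rewrite K_in in N_K.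
  by rewrite K_in in N_rev.
rewrite negb_or -!leNgt => /andP[p_le q_le].
have := label_subr l p_le q_le; case/and5P: l => p_gt0 q_gt0 _ _ _ l.
apply: (IHm _ _ _ _ _ _ l); last by rewrite tri_rev_subr.
  by move: lt_m p_le q_le p_gt0 q_gt0; clear; lia.
by move: o; rewrite /odd_pair; clear; lia.
Qed.

Lemma mem_sides_insert (u v : seq nat) (a b c : nat) (s : nat * nat) :
  s \in sides (u ++ a :: c :: b :: v) ->
  [\/ s = (a, c), s = (c, b) | s \in sides (u ++ a :: b :: v)].
Proof.
rewrite !sides_cat [sides (c :: b :: v)]/(sides _)  !mem_cat !inE.
case/orP=> [->|/or3P[/eqP->|/eqP->|->]]; rewrite ?orbT.
- by constructor 3.
- by constructor 1.
- by constructor 2.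
by constructor 3.
Qed.

(** Here p is a power of 2 with (2 p)^2 <= N, and c^2 = (N / (2 p))^2. When p = q in a label of (a,
    b), this makes the new sides (a, c) and (c, b) paired, where c = a + b. *)
Lemma diagonal_label (c : nat) (p : int) :
  c%:Z * p = M%:Z -> 0 < p -> 2 * p <= r%:Z -> (N %| c%:Z * c%:Z)%Z.
Proof.
case: p => // p eq_M p_gt0 p_le.
have {}eq_M : (c * p)%N = M by apply/eqP; rewrite -eqz_nat PoszM eq_M.
have /(dvdn_pfactor _ _ (isT : prime 2))[k k_le pk] : (p %| 2 ^ n.-1)%N.
  by rewrite -M_def -eq_M dvdn_mull.
have ck : c = (2 ^ (n.-1 - k))%N.
  apply/eqP; rewrite -(@eqn_pmul2r p) // eq_M pk M_def -expnD subnK //.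
have kn : (k.+1.*2 <= n)%N.
  rewrite -(@leq_exp2l 2) // -N_def -addnn expnD expnS -pk.
  by apply: leq_trans r_le; apply: leq_mul; rewrite -lez_nat PoszM.
rewrite -PoszM dvdzE /= ck -expnD N_def dvdn_exp2l //.
by move: kn k_le n_ge2; clear; lia.
Qed.

Definition exact_labels (e : seq nat) (K : seq R) : Prop :=
  {in sides e, forall s : nat * nat, tri s.1 s.2 \notin K ->
    forall p q, label s.1 s.2 p q -> s.1%:Z * p + s.2%:Z * q = M%:Z}.

(** The label may sit on any edge of the outer triangle, because an inserted side can fail to
    inherit one itself. *)
Definition has_labels (e : seq nat) (K : seq R) : Prop :=
  {in sides e, forall s : nat * nat, tri s.1 s.2 \notin K ->
    exists x y p q, [/\ odd_pair x y, tri x y = tri s.1 s.2 & label x y p q]}.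

(** The value is an odd positive multiple of [M], and its double is below 3 r^2 <= 6 M, so the
    factor is 1. *)
Lemma farey_exact_labels : exact_labels e0 K0.
Proof.
move=> s s_in _ p q; have [P le _] := F0.
have /= /andP[a_le b_le] := side_le le s_in.
have /= /andP[a_gt0 b_gt0] := polygon_pos_side P s_in.
have /= co := polygon_coprime P s_in.
move: {s_in} s.1 s.2 a_le b_le a_gt0 b_gt0 co => a b.
move=> a_le b_le a_gt0 b_gt0 co l; have [j eq_j odd_j] := label_odd_multiple l.
case/and5P: l => p_gt0 q_gt0 _ _ /andP[pq_le min_le].
have ab_lt : (a + b < 2 * r)%N.
  have [ar|] := eqVneq a r; last by lia.
  have [br|] := eqVneq b r; last by lia.
  by move: co; rewrite ar br /coprime gcdnn; move: r_ge2; clear; lia.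
have lt3 : a%:Z * (2 * p) + b%:Z * (2 * q) < 3 * (r%:Z * r%:Z).
  clear odd_j eq_j; case/orP: min_le => min_le.
    have q_le : 2 * q <= 2 * r%:Z by move: pq_le min_le; clear; lia.
    have h1 : a%:Z * (2 * p) <= a%:Z * r%:Z by rewrite ler_wpM2l.
    have h2 : b%:Z * (2 * q) <= b%:Z * (2 * r%:Z) by rewrite ler_wpM2l.
    by move: h1 h2 ab_lt a_le b_le r_ge2; clear; nia.
  have p_le : 2 * p <= 2 * r%:Z by move: pq_le min_le; clear; lia.
  have h1 : a%:Z * (2 * p) <= a%:Z * (2 * r%:Z) by rewrite ler_wpM2l.
  have h2 : b%:Z * (2 * q) <= b%:Z * r%:Z by rewrite ler_wpM2l.
  by move: h1 h2 ab_lt a_le b_le r_ge2; clear; nia.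
have r1 : r%:Z * r%:Z <= N%:Z by rewrite -PoszM lez_nat.
have M_gt0 : 0 < M%:Z by have [h] := M_even; lia.
have N2M : N%:Z = 2 * M%:Z by rewrite N_M PoszM.
have j_lt : j < 3.
  rewrite -(ltr_pM2l M_gt0) -eq_j; move: lt3 r1; rewrite N2M; clear; lia.
have j_gt0 : 0 < j.
  rewrite -(pmulr_rgt0 _ M_gt0) -eq_j addr_gt0 // mulr_gt0 //.
have j1 : j = 1 by move: j_lt j_gt0 odd_j; clear; lia.
by rewrite eq_j j1 mulr1.
Qed.

Lemma farey_has_labels : has_labels e0 K0.
Proof.
move=> s s_in N_K; have [P _ _] := F0.
have [K_in|[p [q l]]] := farey_side_label s_in; first by rewrite K_in in N_K.
exists s.1%:Z, s.2%:Z, p, q; split=> //.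
exact: coprime_odd_pair (polygon_coprime P s_in).
Qed.

(** A label of a new side passes back to one of (a, b) with the same value. A label too large for
    this would put the old or the new outer triangle into [K0]. *)
Lemma insert_exact_labels (u v : seq nat) (a b : nat) (K : seq R) :
    odd_pair a b -> {subset K0 <= K} -> tri a b \notin K ->
    (a, b) \in sides (u ++ a :: b :: v) ->
    exact_labels (u ++ a :: b :: v) K ->
  exact_labels (u ++ a :: (a + b)%N :: b :: v) (tri a b :: K).
Proof.
move=> o sub N_K ab_in ex s s_in; rewrite inE negb_or => /andP[ne N_Ks] p q l.
have N_K0 x y : tri x y \notin K -> (tri x y \in K0) = false.
  by move=> N_Kxy; apply: contraNF N_Kxy => /sub.
case: (mem_sides_insert s_in) l N_Ks => [->|->|s_old] /= l N_Ks; last exact: ex.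
- have oc : odd_pair a (a + b)%N by move: o; rewrite /odd_pair PoszD; clear; lia.
  have [big|] := boolP ((r%:Z < 2 * p) || (r%:Z < 2 * q)).
    have := label_small oc l big; rewrite PoszD tri_far_l // -PoszD.
    by rewrite !N_K0.
  rewrite negb_or -!leNgt => /andP[p_le q_le].
  have := label_subr l p_le q_le; rewrite PoszD addrC addKr.
  move=> /(ex _ ab_in N_K) /= <-.
  ring.
- have oc : odd_pair (a + b)%N b by move: o; rewrite /odd_pair PoszD; clear; lia.
  have [big|] := boolP ((r%:Z < 2 * p) || (r%:Z < 2 * q)).
    have := label_small oc l big; rewrite PoszD tri_far_r // -PoszD.
    by rewrite !N_K0.
  rewrite negb_or -!leNgt => /andP[p_le q_le].
  have := label_subl l p_le q_le; rewrite PoszD addrK => /(ex _ ab_in N_K) /= <-.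
  ring.
Qed.

(** The Euclidean step labels one of the two new sides. For the other one, a different edge of its
    outer triangle is labelled with value - M, congruent to [M] modulo N. If p = q, the new sides
    are paired and both are covered. *)
Lemma insert_has_labels (u v : seq nat) (a b : nat) (p q : int) (K : seq R) :
    odd_pair a b -> {subset K0 <= K} -> tri a b \notin K ->
    label a b p q -> a%:Z * p + b%:Z * q = M%:Z ->
    has_labels (u ++ a :: b :: v) K ->
  has_labels (u ++ a :: (a + b)%N :: b :: v) (tri a b :: K).
Proof.
move=> o sub N_K l eq_M has s s_in; rewrite inE negb_or => /andP[ne N_Ks].
have N_K0 x y : tri x y \notin K -> (tri x y \in K0) = false.
  by move=> N_Kxy; apply: contraNF N_Kxy => /sub.
case/and5P: l => p_gt0 q_gt0 _ dg /andP[pq_le min_le].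
have dM (x : int) : x = M%:Z -> (N %| x - M%:Z)%Z by move=> ->; rewrite subrr.
have dNM (x : int) : x = - M%:Z -> (N %| x - M%:Z)%Z.
  by move=> ->; apply/dvdzP; exists (-1); rewrite N_M PoszM; ring.
have gsub (i j : int) : gcdz (i - j) j = gcdz i j.
  by rewrite gcdzC [RHS]gcdzC -[in RHS](subrK j i) gcdzDr.
have cE : (a + b)%N = a%:Z + b%:Z :> int := PoszD a b.
have diag : p = q -> (N %| (a%:Z + b%:Z) * (a%:Z + b%:Z))%Z.
  move=> epq; rewrite -cE; apply: (@diagonal_label _ p) => //; last first.
    by move: min_le; rewrite epq orbb.
  by rewrite cE -eq_M epq; ring.
case: (mem_sides_insert s_in) N_Ks ne => [->|->|s_old] /= N_Ks ne; last exact: has.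
- rewrite cE in N_Ks ne *.
  have oc : odd_pair a (a%:Z + b) by move: o; rewrite /odd_pair; clear; lia.
  have [lt_pq|lt_qp|epq] := ltgtP p q.
  + have [q_le|q_big] := leP (2 * q) r%:Z.
      exists (- (a%:Z + (a%:Z + b))), a%:Z, q, (2 * q - p).
      split; first by move: o; rewrite /odd_pair; clear; lia.
        by rewrite [RHS]tri_rot // [RHS]tri_rot ?odd_pair_rot //; congr tri; ring.
      apply/and5P; split=> //.
      * by move: lt_pq q_gt0; clear; lia.
      * by apply: dNM; rewrite -eq_M; ring.
      * rewrite gcdzC (_ : 2 * q - p = (q - p) + q); last by ring.
        by rewrite gcdzC gcdzDr -gcdzN opprB gcdzC gsub.
      * by move: pq_le q_le p_gt0 q_gt0; clear; lia.
    (* For 2 q > r, this label of the reversed side is too large to continue, so one of the two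
       adjacent triangles would be in [K0]. *)
    have l' : label (a%:Z + b) (- a%:Z) q (q - p).
      apply/and5P; split=> //; first by rewrite subr_gt0.
      * by apply: dM; rewrite -eq_M; ring.
      * by rewrite gcdzC -gcdNz opprB gsub.
      * by move: pq_le min_le lt_pq p_gt0 q_gt0; clear; lia.
    have := label_small (odd_pair_rev oc) l' _; rewrite q_big => /(_ isT).
    by rewrite tri_far_l // tri_opp // !N_K0.
  + exists a%:Z, (a%:Z + b), (p - q), q; split=> //; apply/and5P; split=> //.
    * by rewrite subr_gt0.
    * by apply: dM; rewrite -eq_M; ring.
    * by rewrite gsub.
    * by move: pq_le min_le lt_qp p_gt0 q_gt0; clear; lia.
  case/negP: ne; rewrite -(tri_far_r o); apply/eqP/tri_same_edge => //.
    by move: o; rewrite /odd_pair; clear; lia.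
  by rewrite /same_edge -dvdz_opp; congr (_ %| _)%Z: (diag epq); ring.
rewrite cE in N_Ks ne *.
have oc : odd_pair (a%:Z + b) b by move: o; rewrite /odd_pair; clear; lia.
have [lt_pq|lt_qp|epq] := ltgtP p q.
- exists (a%:Z + b), b%:Z, p, (q - p); split=> //; apply/and5P; split=> //.
  + by rewrite subr_gt0.
  + by apply: dM; rewrite -eq_M; ring.
  + by rewrite gcdzC gsub gcdzC.
  + by move: pq_le min_le lt_pq p_gt0 q_gt0; clear; lia.
- have [p_le|p_big] := leP (2 * p) r%:Z.
    exists b%:Z, (- (a%:Z + b + b)), (2 * p - q), p.
    split; first by move: o; rewrite /odd_pair; clear; lia.
      by rewrite [RHS]tri_rot //; congr tri; ring.
    apply/and5P; split=> //.
    + by move: lt_qp p_gt0; clear; lia.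
    + by apply: dNM; rewrite -eq_M; ring.
    + rewrite (_ : 2 * p - q = (p - q) + p); last by ring.
      by rewrite gcdzC gcdzDr -gcdzN opprB gcdzC gsub gcdzC.
    + by move: pq_le p_le p_gt0 q_gt0; clear; lia.
  have l' : label b (- (a%:Z + b)) (p - q) p.
    apply/and5P; split=> //; first by rewrite subr_gt0.
    + by apply: dNM; rewrite -eq_M; ring.
    + by rewrite -gcdNz opprB gsub gcdzC.
    + by move: pq_le min_le lt_qp p_gt0 q_gt0; clear; lia.
  have ob : odd_pair b (- (a%:Z + b)) by move: o; rewrite /odd_pair; clear; lia.
  have := label_small ob l' _; rewrite p_big orbT => /(_ isT).
  rewrite tri_far_r // -[tri _ (- b%:Z)]tri_opp ?opprK; last first.
    by move: o; rewrite /odd_pair; clear; lia.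
  by rewrite !N_K0.
case/negP: ne; rewrite -(tri_far_l o); apply/eqP/tri_same_edge => //.
  by move: o; rewrite /odd_pair; clear; lia.
by rewrite /same_edge -dvdz_opp; congr (_ %| _)%Z: (diag epq); ring.
Qed.

Lemma polygon_exists : exists e K,
  [/\ polygon e K, obtained_from e0 e, {in e, forall a, (a <= M)%N}
    & {in sides e, forall s : nat * nat, tri s.1 s.2 \in K}].
Proof.
pose inv e K := [/\ polygon e K /\ obtained_from e0 e,
  {in e, forall a, (a <= M)%N}, {subset K0 <= K}, exact_labels e K & has_labels e K].
pose goal e (K : seq R) := {in sides e, forall s : nat * nat, tri s.1 s.2 \in K}.
have [P0 le0 _] := F0.
have [] // := @polygon_saturate inv goal _ _ e0 K0.
- by move=> e K [[]].
- move=> e K [[P far] le sub ex has].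
  have [/allP|/allPn[s0 s0_in N_K0]] :=
    boolP (all (fun s : nat * nat => tri s.1 s.2 \in K) (sides e)); first by left.
  right; have [x [y [p0 [q0 [oxy txy l0]]]]] := has _ s0_in N_K0.
  rewrite -txy in N_K0.
  have [[a b] ab_in [/= N_K [p [q l]]]] := labelled_side_exists P sub oxy l0 N_K0.
  have o := coprime_odd_pair (polygon_coprime P ab_in).
  have eq_M := ex _ ab_in N_K _ _ l; rewrite /= in eq_M.
  have [u [v /= eq_e]] := mem_sides ab_in; rewrite {}eq_e in P far le ex has ab_in.
  exists (u ++ a :: (a + b)%N :: b :: v), (tri a b :: K); split=> //.
  split; [split|..].
  + exact: polygon_insert.
  + exact: Obtained_insert.
  (* Since p and q are at least 1, a + b <= a p + b q = M. *)
  + move=> c; rewrite mem_cat !inE => c_in.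
    have [->|ne] := eqVneq c (a + b)%N; last first.
      by apply: le; rewrite mem_cat !inE; move: c_in; rewrite (negPf ne).
    have /= /andP[a_gt0 b_gt0] := polygon_pos_side P ab_in.
    have /and5P[p_gt0 q_gt0 _ _ _] := l.
    by move: eq_M p_gt0 q_gt0; clear; nia.
  + by move=> t /sub K_t; rewrite inE K_t orbT.
  + exact: insert_exact_labels.
  + exact: (insert_has_labels o sub N_K l eq_M).
- split=> //; first by split=> //; exact: Obtained_refl.
  + move=> a /le0 a_le; apply: leq_trans a_le _.
    by move: r_le r_ge2; rewrite N_M; clear; nia.
  + exact: farey_exact_labels.
  + exact: farey_has_labels.
by move=> e [K [[[P far] le _ _ _] done]]; exists e, K.
Qed.

End Saturation.

End Triangles.

(** * From polygons to Farey sequences of the group *)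

Lemma obtained_from_trans (s e e' : seq nat) :
  obtained_from s e -> obtained_from e e' -> obtained_from s e'.
Proof. by move=> se; elim=> // u v a b _; apply: Obtained_insert. Qed.

Lemma Nat_sqrt_bounds (k : nat) :
  (Nat.sqrt k * Nat.sqrt k <= k < (Nat.sqrt k).+1 * (Nat.sqrt k).+1)%N.
Proof. by have := PeanoNat.Nat.sqrt_spec k; lia. Qed.

Theorem theorem1p1 (n : nat) (hn : 2 <= n) :
  exists e : seq nat,
    [/\ farey_sequence_of_Gamma0 (2 ^ n) e,
        forall i : 'I_(size e), nth 0 e i <= 2 ^ n.-1
      & exists! j : 'I_(size e), nth 0 e j = 2 ^ n.-1].
Proof.
have /andP[r_le r_gt] := Nat_sqrt_bounds (2 ^ n).
have [e0 [K0 [far0 F0]]] := farey_polygon_exists hn erefl erefl r_le r_gt.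
have [e [K [P far le done]]] := polygon_exists hn erefl erefl r_le r_gt F0.
have [_ le0 big0] := F0.
have far_e : farey_sequence e by apply: obtained_from_trans far.
exists e; split; last 2 first.
- by move=> i; apply/le/mem_nth.
- apply: (polygon_top hn erefl erefl P done le).
  by rewrite nth0 (obtained_from_head far_e).
split=> //.
- by rewrite (farey_denominatorsE far0 le0 big0).
- exists (2 ^ n + 2 ^ n.-1); first by apply: Gamma0_index; apply: ltnW.
  (* The index is N + M = 3 M, whose third is the number [M] of triangles. *)
  rewrite (polygon_full_size hn erefl erefl P done) -{2}(ltn_predK hn) expnS.
  by rewrite -mulSnr mulKn.
by move=> s s_in _; apply: (polygon_paired hn erefl erefl P s_in); apply: done.
Qed.
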